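(* There exists a hyponormal composition operator $C$ in an $L^2$-space over a $\sigma$-finite measure such that $\mathcal{D}(\Delta_t(C))=\{0\}$ for every $t\in(0,1]$ and $\Delta_t(C^* )$ is not closable for every $t\in(0,1)$.
   Context: For a $\sigma$-finite measure space $(X,\mathcal{A},\mu)$ and a measurable map $\phi:X\to X$ that is nonsingular (i.e. $\mu(\phi^{-1}(A))=0$ whenever $\mu(A)=0$), the composition operator $C$ in (complex) $L^2(\mu)$ with symbol $\phi$ is given by $\mathcal{D}(C)=\{f\in L^2(\mu):f\circ\phi\in L^2(\mu)\}$ and $Cf=f\circ\phi$; such an operator is closed. A densely defined operator $T$ is hyponormal if $\mathcal{D}(T)\subset\mathcal{D}(T^* )$ and $\|Tf\|\ge\|T^*f\|$ for every $f\in\mathcal{D}(T)$. For a closed densely defined operator $T$ in a Hilbert space with polar decomposition $T=U|T|$ ($|T|=(T^*T)^{1/2}$, $U$ a partial isometry with kernel $\mathcal{N}(T)$) and $t\in(0,1]$, the $t$-Aluthge transform is $\Delta_t(T)=|T|^tU|T|^{1-t}$ with the natural domain of the composition; $|T|^0=I$ is the identity on the whole space. An operator is closable if the closure of its graph is the graph of an operator. *)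

(* Defs.v *)
From HB Require Import structures.
From mathcomp Require Import all_boot all_order all_algebra.
From mathcomp Require Import ring_quotient sesquilinear complex ring lra.
From mathcomp Require Import all_classical all_reals all_analysis.
From mathcomp Require Import measurable_realfun.
Set Implicit Arguments.
Unset Strict Implicit.
Unset Printing Implicit Defensive.
Import Order.TTheory GRing.Theory Num.Theory.
Import numFieldNormedType.Exports.
Local Open Scope classical_set_scope.
Local Open Scope ring_scope.
Local Open Scope quotient_scope.

(* |z|^2 as an element of R. *)
Definition sqmod (R : realType) (z : R[i]) : R :=
  complex.Re z ^+ 2 + complex.Im z ^+ 2.

Section SquareIntegrable.
Context d (X : measurableType d) (R : realType).
Variable mu : {measure set X -> \bar R}.
Implicit Types (f g : X -> R[i]) (z w : R[i]).

Definition cmeasurable f :=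
  measurable_fun setT (fun x => complex.Re (f x)) /\
  measurable_fun setT (fun x => complex.Im (f x)).

Definition L2pred : {pred X -> R[i]} :=
  mem [set f | cmeasurable f /\ (\int[mu]_x (sqmod (f x))%:E < +oo)%E].

Lemma L2predP f : reflect
  (cmeasurable f /\ (\int[mu]_x (sqmod (f x))%:E < +oo)%E) (f \in L2pred).
Proof. by apply: (iffP idP) => [/set_mem|/mem_set]. Qed.

Lemma sqmod_ge0 z : 0 <= sqmod z.
Proof. by rewrite addr_ge0// sqr_ge0. Qed.

Lemma sqmodD z w : sqmod (z + w) <= 2 * (sqmod z + sqmod w).
Proof.
case: z w => [a b] [a' b']; rewrite /sqmod/=.
have := sqr_ge0 (a - a'); have := sqr_ge0 (b - b'); rewrite !expr2; lra.
Qed.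

Lemma sqmodM z w : sqmod (z * w) = sqmod z * sqmod w.
Proof. by case: z w => [a b] [a' b']; rewrite /sqmod/=; ring. Qed.

Lemma sqmod_conjM z w :
  `|complex.Re (z * w^* )| <= sqmod z + sqmod w /\
  `|complex.Im (z * w^* )| <= sqmod z + sqmod w.
Proof.
case: z w => [a b] [a' b']; rewrite /sqmod/= !ler_norml.
have := sqr_ge0 (a - a'); have := sqr_ge0 (b - b').
have := sqr_ge0 (a + a'); have := sqr_ge0 (b + b').
have := sqr_ge0 (a - b'); have := sqr_ge0 (b - a').
have := sqr_ge0 (a + b'); have := sqr_ge0 (b + a').
by rewrite !expr2 => *; split; apply/andP; split; lra.
Qed.

Lemma cmeasurableD f g :
  cmeasurable f -> cmeasurable g -> cmeasurable (fun x => f x + g x).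
Proof.
move=> [f1 f2] [g1 g2]; split.
  rewrite (_ : (fun _ => _) =
    (fun x => complex.Re (f x) + complex.Re (g x))); last first.
    by apply/funext => x; case: (f x) (g x) => ? ? [].
  exact: measurable_funD.
rewrite (_ : (fun _ => _) =
  (fun x => complex.Im (f x) + complex.Im (g x))); last first.
  by apply/funext => x; case: (f x) (g x) => ? ? [].
exact: measurable_funD.
Qed.

Lemma cmeasurableM f g :
  cmeasurable f -> cmeasurable g -> cmeasurable (fun x => f x * g x).
Proof.
move=> [f1 f2] [g1 g2]; split.
  rewrite (_ : (fun _ => _) = (fun x =>
    complex.Re (f x) * complex.Re (g x) -
    complex.Im (f x) * complex.Im (g x))); last first.
    by apply/funext => x; case: (f x) (g x) => ? ? [].
  by apply: measurable_funB; apply: measurable_funM.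
rewrite (_ : (fun _ => _) = (fun x =>
  complex.Re (f x) * complex.Im (g x) +
  complex.Im (f x) * complex.Re (g x))); last first.
  by apply/funext => x; case: (f x) (g x) => ? ? [].
by apply: measurable_funD; apply: measurable_funM.
Qed.

Lemma cmeasurable_cst z : cmeasurable (fun=> z).
Proof. by split; exact: measurable_cst. Qed.

Lemma cmeasurable_conj f : cmeasurable f -> cmeasurable (fun x => (f x)^*).
Proof.
move=> [f1 f2]; split.
  rewrite (_ : (fun _ => _) = (fun x => complex.Re (f x)))//.
  by apply/funext => x; case: (f x).
rewrite (_ : (fun _ => _) = (fun x => - complex.Im (f x))); last first.
  by apply/funext => x; case: (f x).
exact: measurableT_comp.
Qed.

Lemma measurable_sqmod f :
  cmeasurable f -> measurable_fun setT (fun x => sqmod (f x)).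
Proof. by move=> [f1 f2]; apply: measurable_funD; apply: measurable_funX. Qed.

Lemma L2pred_submod_closed : submod_closed L2pred.
Proof.
split=> [|a f g /L2predP[mf sf] /L2predP[mg sg]]; apply/L2predP.
  split; first exact: cmeasurable_cst.
  rewrite integral0_eq// => x _.
  by rewrite /sqmod /= expr0n /= addr0.
have maf : cmeasurable (fun x => a * f x).
  exact: cmeasurableM (cmeasurable_cst a) mf.
split; first exact: (cmeasurableD maf mg).
have mfE : measurable_fun setT (fun x => (sqmod (f x))%:E).
  exact/measurable_EFinP/measurable_sqmod.
have mgE : measurable_fun setT (fun x => (sqmod (g x))%:E).
  exact/measurable_EFinP/measurable_sqmod.
have mafE : measurable_fun setT (fun x => ((sqmod a)%:E * (sqmod (f x))%:E)%E).
  apply/measurable_EFinP; apply: measurable_funM => //.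
  exact: measurable_sqmod.
apply: (@le_lt_trans _ _ (\int[mu]_x (2%:E *
    ((sqmod a)%:E * (sqmod (f x))%:E + (sqmod (g x))%:E)))%E).
  apply: ge0_le_integral => //.
  - by move=> x _; rewrite lee_fin sqmod_ge0.
  - by apply/measurable_EFinP/measurable_sqmod; exact: cmeasurableD maf mg.
  - apply/measurable_EFinP; apply: measurable_funM => //.
    apply: measurable_funD; last exact: measurable_sqmod.
    by apply: measurable_funM => //; exact: measurable_sqmod.
  - move=> x _; rewrite -[leRHS]/((2 * (sqmod a * sqmod (f x) +
      sqmod (g x)))%:E) lee_fin -sqmodM.
    exact: sqmodD.
have pa x : (0 <= (sqmod a)%:E * (sqmod (f x))%:E)%E.
  by rewrite mule_ge0// lee_fin sqmod_ge0.
have pg x : (0 <= (sqmod (g x))%:E)%E by rewrite lee_fin sqmod_ge0.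
rewrite ge0_integralZl_EFin//; [|by move=> x _; exact: adde_ge0|
  exact: emeasurable_funD].
rewrite ge0_integralD// ge0_integralZl_EFin ?sqmod_ge0//; last first.
  by move=> x _; rewrite lee_fin sqmod_ge0.
rewrite lte_mul_pinfty// lte_add_pinfty// lte_mul_pinfty//.
by rewrite lee_fin sqmod_ge0.
Qed.

HB.instance Definition _ :=
  GRing.isSubmodClosed.Build _ _ L2pred L2pred_submod_closed.

Record L2fun := MkL2fun { L2val :> X -> R[i] ; L2valP : L2val \in L2pred }.
HB.instance Definition _ := [isSub for L2val].
HB.instance Definition _ := [Choice of L2fun by <:].
HB.instance Definition _ := [SubChoice_isSubLmodule of L2fun by <:].

Definition L2null : {pred L2fun} :=
  mem [set f : L2fun | {ae mu, forall x, f x = 0}].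

Lemma L2nullP (f : L2fun) : reflect {ae mu, forall x, f x = 0} (f \in L2null).
Proof. by apply: (iffP idP) => [/set_mem|/mem_set]. Qed.

Lemma L2null_submod_closed : submod_closed L2null.
Proof.
split=> [|a f g /L2nullP f0 /L2nullP g0]; apply/L2nullP; first exact: aeW.
apply: filterS2 f0 g0 => x fx gx.
by rewrite /= [LHS](_ : _ = a * f x + g x)// fx gx mulr0 addr0.
Qed.

HB.instance Definition _ :=
  GRing.isSubmodClosed.Build _ _ L2null L2null_submod_closed.

Definition L2 := Quotient.quot L2null.
HB.instance Definition _ := GRing.Zmodule.on L2.
HB.instance Definition _ := EqQuotient.on L2.

Definition L2rep (F : L2) : L2fun := repr F.

Lemma L2_eqP (f g : L2fun) :
  reflect {ae mu, forall x, f x = g x} (\pi_L2 f == \pi_L2 g).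
Proof.
rewrite -[X in reflect _ X]Quotient.idealrBE.
apply: (iffP (L2nullP _)); apply: filterS => x /=.
  by move=> /eqP; rewrite [X in X == _](_ : _ = f x - g x)// subr_eq0 => /eqP.
by move=> fg; rewrite [LHS](_ : _ = f x - g x)// fg subrr.
Qed.

Lemma L2_ind (P : L2 -> Prop) : (forall f : L2fun, P (\pi_L2 f)) ->
  forall F, P F.
Proof. by move=> Pf F; rewrite -[F]reprK. Qed.

Lemma pi_L2D (f g : L2fun) : \pi_L2 (f + g) = \pi_L2 f + \pi_L2 g.
Proof. by rewrite [RHS]piE. Qed.

Definition scaleL2 z (F : L2) : L2 := \pi_L2 (z *: repr F).

Lemma pi_scaleL2 z (f : L2fun) : scaleL2 z (\pi_L2 f) = \pi_L2 (z *: f).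
Proof.
apply/eqP/L2_eqP; have /eqP/L2_eqP := reprK (\pi_L2 f).
apply: filterS => x fE.
by rewrite [LHS](_ : _ = z * repr (\pi_L2 f) x)// fE.
Qed.

Lemma scaleL2A a b (F : L2) : scaleL2 a (scaleL2 b F) = scaleL2 (a * b) F.
Proof. by elim/L2_ind: F => f; rewrite !pi_scaleL2 scalerA. Qed.

Lemma scale1L2 : left_id 1 scaleL2.
Proof. by elim/L2_ind => f; rewrite pi_scaleL2 scale1r. Qed.

Lemma scaleL2Dr : right_distributive scaleL2 +%R.
Proof.
move=> a; elim/L2_ind => f; elim/L2_ind => g.
by rewrite -pi_L2D !pi_scaleL2 scalerDr pi_L2D.
Qed.

Lemma scaleL2Dl F : {morph scaleL2^~ F : a b / a + b}.
Proof.
by move=> a b; elim/L2_ind: F => f; rewrite !pi_scaleL2 scalerDl pi_L2D.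
Qed.

HB.instance Definition _ := GRing.Zmodule_isLmodule.Build R[i] L2
  scaleL2A scale1L2 scaleL2Dr scaleL2Dl.

Lemma pi_L2Z a (f : L2fun) : \pi_L2 (a *: f) = a *: \pi_L2 f.
Proof. by rewrite -pi_scaleL2. Qed.

Definition cintegrable f :=
  mu.-integrable setT (fun x => (complex.Re (f x))%:E) /\
  mu.-integrable setT (fun x => (complex.Im (f x))%:E).

Definition cintegral f : R[i] :=
  (\int[mu]_x complex.Re (f x) +i* \int[mu]_x complex.Im (f x))%C.

Lemma cintegralD f g : cintegrable f -> cintegrable g ->
  cintegral (fun x => f x + g x) = cintegral f + cintegral g.
Proof.
move=> [f1 f2] [g1 g2]; rewrite /cintegral.
transitivity (
  (\int[mu]_x (complex.Re (f x) + complex.Re (g x)) +i*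
   \int[mu]_x (complex.Im (f x) + complex.Im (g x)))%C).
  by congr (_ +i* _)%C; apply: eq_Rintegral => x _; case: (f x) (g x) => ? ? [].
by rewrite !RintegralD.
Qed.

Lemma cintegralZ a f : cintegrable f ->
  cintegral (fun x => a * f x) = a * cintegral f.
Proof.
move=> [f1 f2]; rewrite /cintegral; case: a => a b.
have h (r : R) (u : X -> R) : mu.-integrable setT (fun x => (u x)%:E) ->
    mu.-integrable setT (fun x => (r * u x)%:E).
  by move=> iu; under eq_fun do rewrite EFinM; exact: integrableZl.
transitivity (
  (\int[mu]_x (a * complex.Re (f x) - b * complex.Im (f x)) +i*
   \int[mu]_x (a * complex.Im (f x) + b * complex.Re (f x)))%C).
  by congr (_ +i* _)%C; apply: eq_Rintegral => x _; case: (f x).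
rewrite RintegralB//; [|exact: h|exact: h].
rewrite RintegralD//; [|exact: h|exact: h].
by rewrite !RintegralZl.
Qed.

Lemma cintegral_conj f : cintegrable f ->
  cintegral (fun x => (f x)^* ) = (cintegral f)^*.
Proof.
move=> [f1 f2]; rewrite /cintegral.
transitivity (
  (\int[mu]_x complex.Re (f x) +i* \int[mu]_x (-1 * complex.Im (f x)))%C).
  by congr (_ +i* _)%C; apply: eq_Rintegral => x _; case: (f x) => ? ?//=;
    rewrite mulN1r.
by rewrite RintegralZl// mulN1r.
Qed.

Definition L2fun_dot (f g : L2fun) : R[i] :=
  cintegral (fun x => f x * (g x)^* ).

Lemma L2fun_cmeas (f : L2fun) : cmeasurable f.
Proof. by have /L2predP[] := L2valP f. Qed.

Lemma L2fun_sqmod (f : L2fun) :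
  mu.-integrable setT (fun x => (sqmod (f x))%:E).
Proof.
have /L2predP[mf sf] := L2valP f; apply/integrableP; split.
  exact/measurable_EFinP/measurable_sqmod.
by under eq_integral => x _ do rewrite gee0_abs ?lee_fin ?sqmod_ge0//.
Qed.

Lemma L2fun_dot_integrable (f g : L2fun) :
  cintegrable (fun x => f x * (g x)^* ).
Proof.
have [m1 m2] := cmeasurableM (L2fun_cmeas f)
  (cmeasurable_conj (L2fun_cmeas g)).
have ifg : mu.-integrable setT
    ((fun x => (sqmod (f x))%:E) \+ (fun x => (sqmod (g x))%:E))%E.
  by apply: integrableD => //; exact: L2fun_sqmod.
have h x : `|sqmod (f x) + sqmod (g x)| = sqmod (f x) + sqmod (g x).
  by rewrite ger0_norm// addr_ge0// sqmod_ge0.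
split; apply: le_integrable ifg => //; do ?[exact/measurable_EFinP] => x _;
  by rewrite /= lee_fin h; have [] := sqmod_conjM (f x) (g x).
Qed.

Lemma eq_L2fun_dot (f f' g g' : L2fun) :
  \pi_L2 f = \pi_L2 f' -> \pi_L2 g = \pi_L2 g' ->
  L2fun_dot f g = L2fun_dot f' g'.
Proof.
move=> /eqP/L2_eqP ff' /eqP/L2_eqP gg'.
have [[/integrableP[m1 _] /integrableP[m2 _]]
      [/integrableP[m1' _] /integrableP[m2' _]]] :=
  (L2fun_dot_integrable f g, L2fun_dot_integrable f' g').
by congr (_ +i* _)%C; congr fine; apply: ae_eq_integral => //;
  apply: filterS2 ff' gg' => x -> ->.
Qed.

Definition L2dot (F G : L2) : R[i] := L2fun_dot (repr F) (repr G).

Lemma L2dot_pi (f g : L2fun) : L2dot (\pi_L2 f) (\pi_L2 g) = L2fun_dot f g.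
Proof. by apply: eq_L2fun_dot; rewrite reprK. Qed.

Lemma L2dot_conj (F G : L2) : L2dot F G = (L2dot G F)^*.
Proof.
rewrite /L2dot /L2fun_dot -cintegral_conj; last exact: L2fun_dot_integrable.
by congr cintegral; apply/funext => x; rewrite rmorphM /= conjCK mulrC.
Qed.

Lemma L2dot_linearl (G : L2) : linear_for *%R (L2dot^~ G).
Proof.
move=> a; elim/L2_ind => f; elim/L2_ind => f'; elim/L2_ind: G => g.
rewrite -pi_L2Z -pi_L2D !L2dot_pi /L2fun_dot.
have ifg := L2fun_dot_integrable f g; have ig := L2fun_dot_integrable f' g.
rewrite -cintegralZ// -cintegralD//.
  by congr cintegral; apply/funext => x; rewrite mulrA -mulrDl.
have := L2fun_dot_integrable (a *: f) g; congr cintegrable; apply/funext => x.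
by rewrite mulrA.
Qed.

Lemma L2dot_bilinear : bilinear_for *%R (Num.conj \; *%R) L2dot.
Proof.
split; first exact: L2dot_linearl.
move=> F a G G'; rewrite /= L2dot_conj L2dot_linearl rmorphD rmorphM /=.
by rewrite -!L2dot_conj.
Qed.

HB.instance Definition _ := bilinear_isBilinear.Build R[i] L2 L2 R[i]
  *%R (Num.conj \; *%R) L2dot L2dot_bilinear.

Lemma L2dot_herm (F G : L2) : L2dot F G = (-1) ^+ false * (L2dot G F)^*.
Proof. by rewrite mul1r -L2dot_conj. Qed.

HB.instance Definition _ := isHermitianSesquilinear.Build R[i] L2 false
  Num.conj L2dot L2dot_herm.

Lemma L2dot_gt0 (F : L2) : F != 0 -> 0 < L2dot F F.
Proof.
elim/L2_ind: F => f f0; rewrite L2dot_pi.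
have -> : L2fun_dot f f = (\int[mu]_x sqmod (f x))%:C%C.
  congr (_ +i* _)%C.
    apply: eq_Rintegral => x _; case: (f x) => a b.
    by rewrite /sqmod/= mulrN opprK -!expr2.
  rewrite (_ : (fun x => _) = cst 0) ?Rintegral_cst ?mul0r//.
  by apply/funext => x; case: (f x) => a b /=; ring.
rewrite ltcR lt_neqAle Rintegral_ge0 ?andbT; last first.
  by move=> x _; exact: sqmod_ge0.
apply: contra f0 => /eqP/esym f0.
rewrite (_ : 0 = \pi_L2 0); last by rewrite [LHS]piE.
apply/L2_eqP.
have /integrableP[mf _] := L2fun_sqmod f.
have : (\int[mu]_x `|(sqmod (f x))%:E| = 0)%E.
  under eq_integral do rewrite gee0_abs ?lee_fin ?sqmod_ge0//.
  rewrite -[LHS]fineK; first exact/congr1.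
  by apply: integral_fune_fin_num => //; exact: L2fun_sqmod.
move=> /(ae_eq_integral_abs mu measurableT mf); apply: filterS => x /(_ I)[].
case: (f x) => a b /eqP.
rewrite /sqmod /= paddr_eq0 ?sqr_ge0// !sqrf_eq0 => /andP[/eqP-> /eqP->].
by [].
Qed.

HB.instance Definition _ := isDotProduct.Build R[i] L2 L2dot L2dot_gt0.

Definition L2inner : {dot L2 for Num.conj} := L2dot.

End SquareIntegrable.

(* Unbounded operators are represented by their graphs, as subsets of H * H. *)
Section UnboundedOperators.
Context (R : realType) (H : lmodType R[i]) (dot : {dot H for Num.conj}).
Implicit Types (S T A B D : set (H * H)) (x y z : H) (t : R).

Local Notation "''[' u , v ]" := (dot u v) : ring_scope.

Definition hnorm x : R := Num.sqrt (complex.Re '[x, x]).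

Definition is_operator T :=
  [/\ T (0, 0),
      forall (a : R[i]) p q, T p -> T q ->
        T (a *: p.1 + q.1, a *: p.2 + q.2) &
      forall x y z, T (x, y) -> T (x, z) -> y = z].

Definition dom T : set H := [set x | exists y, T (x, y)].

Definition oker T : set H := [set x | T (x, 0)].

Definition graph (U : H -> H) : set (H * H) := [set p | p.2 = U p.1].

Definition ocomp S T : set (H * H) :=
  [set p | exists2 z, T (p.1, z) & S (z, p.2)].

Definition densely_defined T :=
  forall x (e : R), 0 < e -> exists2 y, dom T y & hnorm (x - y) < e.

(* (x, y) is in the graph of the adjoint iff '[T u, x] = '[u, y] for all u in
   the domain of T; this is single-valued when T is densely defined. *)
Definition adjoint T : set (H * H) :=
  [set p | forall q, T q -> '[q.2, p.1] = '[q.1, p.2]].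

Definition gclosure T : set (H * H) :=
  [set p | forall e : R, 0 < e ->
     exists q, [/\ T q, hnorm (p.1 - q.1) < e & hnorm (p.2 - q.2) < e]].

Definition closable T := is_operator (gclosure T).

Definition hyponormal T :=
  [/\ densely_defined T, dom T `<=` dom (adjoint T) &
      forall x y z, T (x, y) -> adjoint T (x, z) -> hnorm z <= hnorm y].

(* Borel spectral measures on the real line; the values of sproj outside the
   Borel sets are irrelevant. As sproj M is an orthogonal projection,
   hnorm (sproj M x) ^+ 2 is '[sproj M x, x]. *)
Record spectral_measure := SpectralMeasure {
  sproj : set (measurableTypeR R) -> {linear H -> H} ;
  sproj_idem : forall M, measurable M ->
    forall x, sproj M (sproj M x) = sproj M x ;
  sproj_selfadj : forall M, measurable M ->
    forall x y, '[sproj M x, y] = '[x, sproj M y] ;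
  sproj0 : forall x, sproj set0 x = 0 ;
  sprojT : forall x, sproj setT x = x ;
  sproj_sigma_additive : forall x,
    semi_sigma_additive (fun M => (hnorm (sproj M x) ^+ 2)%:E) }.

Section ScalarSpectralMeasure.
Variables (E : spectral_measure) (x : H).

Definition smeas (M : set (measurableTypeR R)) : \bar R :=
  (hnorm (sproj E M x) ^+ 2)%:E.

Let smeas0 : smeas set0 = 0%E.
Proof.
by rewrite /smeas sproj0 /hnorm linear0r sqrtr0 expr0n.
Qed.

Let smeas_ge0 M : (0 <= smeas M)%E.
Proof. by rewrite lee_fin sqr_ge0. Qed.

HB.instance Definition _ := isMeasure.Build _ (measurableTypeR R) R smeas
  smeas0 smeas_ge0 (@sproj_sigma_additive E x).

End ScalarSpectralMeasure.

(* A is the operator given by the integral of f with respect to E; on its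
   (dense) domain it is determined by its quadratic form, by polarization. *)
Definition is_spectral_integral (E : spectral_measure) (f : R -> R) A :=
  [/\ is_operator A,
      dom A = [set x | (\int[smeas E x]_r ((f r) ^+ 2)%:E < +oo)%E] &
      forall x y, A (x, y) -> '[y, x] = (\int[smeas E x]_r f r)%:C%C].

(* B = S ^ t for a nonnegative selfadjoint S with spectral measure E. Since
   0 `^ 0 = 1, the power S ^ 0 is the identity on the whole of H. *)
Definition is_power S t B := exists E : spectral_measure,
  [/\ forall x, sproj E `[0, +oo[ x = x,
      is_spectral_integral E id S &
      is_spectral_integral E (fun r => r `^ t) B].

Definition is_modulus T A := is_power (ocomp (adjoint T) T) 2^-1 A.

Definition partial_isometry (U : {linear H -> H}) :=
  (exists M : R, forall x, hnorm (U x) <= M * hnorm x) /\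
  forall x, (forall y, U y = 0 -> '[x, y] = 0) -> hnorm (U x) = hnorm x.

Definition is_polar T (U : {linear H -> H}) A :=
  [/\ is_modulus T A, partial_isometry U,
      [set x | U x = 0] = oker T & T = ocomp (graph U) A].

(* D = |T|^t U |T|^(1 - t); the polar decomposition and the powers of |T| are
   unique, hence so is D. *)
Definition is_aluthge t T D := exists (U : {linear H -> H}) A B B',
  [/\ is_polar T U A, is_power A t B, is_power A (1 - t) B' &
      D = ocomp B (ocomp (graph U) B')].

End UnboundedOperators.

Definition nonsingular d (X : measurableType d) (R : realType)
    (mu : {measure set X -> \bar R}) (phi : X -> X) :=
  forall M, measurable M -> mu M = 0%E -> mu (phi @^-1` M) = 0%E.

(* For nonsingular phi this does not depend on the representatives. *)
Definition composition_operator d (X : measurableType d) (R : realType)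
    (mu : {measure set X -> \bar R}) (phi : X -> X) : set (L2 mu * L2 mu) :=
  [set p | {ae mu, forall x, L2rep p.2 x = L2rep p.1 (phi x)}].

Arguments L2inner {d X R} mu.
Arguments composition_operator {d X R} mu phi.

(* Main.v *)
Require Import Defs.
From HB Require Import structures.
From mathcomp Require Import all_boot all_order all_algebra.
From mathcomp Require Import ring_quotient sesquilinear complex ring lra.
From mathcomp Require Import all_classical all_reals all_analysis.
From mathcomp Require Import measurable_realfun.
Set Implicit Arguments.
Unset Strict Implicit.
Unset Printing Implicit Defensive.
Import Order.TTheory GRing.Theory Num.Theory.
Import numFieldNormedType.Exports.
Local Open Scope classical_set_scope.
Local Open Scope ring_scope.
Local Open Scope quotient_scope.

(** The space is a discrete measure space on the vertices of an infinite tree: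
the vertices are the finite sequences of natural numbers, coded as natural
numbers, and the symbol [parent] deletes the first entry (the empty sequence,
the root, is sent to itself). Write m for the mass of a vertex, h for the
quotient of the mass of its fibre by its own mass, and k for the square root of
h. Then C = U A, where A is the multiplication by k and U, which sends f to
(f / k) o parent, is an isometry; this is the polar decomposition of C, and
with V the adjoint of U, the adjoint A V of C has the polar decomposition
V (U A V). Hence
  Delta_t(C)   = A^t U A^(1-t)         and
  Delta_t(C^* ) = U A^t V A^(1-t) V     for 0 < t < 1.

The masses are chosen so that the children of a vertex have k at least as large
as their parent ([slope_parent]) and so that, along the children of any vertex,
m k^(2s) is unbounded for every s > 0 ([slope_growth]): the mass of the i-th
child is proportional to 2^-(i+1), which makes fibres finite, while its k is
2^(i^2) times that of the parent.

- Monotonicity of k along edges gives hyponormality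
  ([composition_hyponormal]): V intertwines the multiplications by k o parent
  and by k, so |A V f| <= |(k o parent) f| <= |A f| = |C f|.
- If f is in the domain of Delta_t(C) and f(n) is not 0, then the image of f has
  at a child x of n a value proportional to k(x)^t, and the square of its norm
  dominates a multiple of m(x) k(x)^(2t), which is unbounded over the children
  x of n ([dom_aluthge_composition]).
- For a child x of n the operator Delta_t(C^* ) maps the indicator of the fibre
  over x, suitably normalized, to a fixed multiple of the indicator of the fibre
  over n, while the square of the norm of the normalized indicator is
  1 / (m(x) k(x)^(2(1-t))). The latter gets arbitrarily small, so the closure of
  the graph contains a pair (0, g) with g not 0
  ([aluthge_adjoint_not_closable]).

The rest of the work identifies the two Aluthge transforms. On a discrete space
multiplication operators have explicit spectral measures ([cut]), hence explicit
powers ([mulop_power]); an isometry transports these to U A V ([transfer]). Both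
adjoints follow formally from A being selfadjoint and U being an isometry
([adjoint_isometryl], [adjoint_isometryr]), so that integration over the fibres
is needed only to compute the norm of f o parent ([pushforward_fibre]). *)

(** * Inner product spaces *)

Lemma conj_realC (R : realType) (r : R) : (r%:C%C)^* = r%:C%C :> R[i].
Proof. by rewrite conj_Creal// complex_real. Qed.

Section InnerProduct.
Context (R : realType) (H : lmodType R[i]) (dot : {dot H for Num.conj}).
Implicit Types x y z : H.

Local Notation "''[' u , v ]" := (dot u v) : ring_scope.
Local Notation hn := (hnorm dot).

Lemma dot_conj x y : '[x, y] = '[y, x]^*.
Proof. by rewrite hermC expr0 mul1r. Qed.

Lemma dotZl a x y : '[a *: x, y] = a * '[x, y].
Proof. by rewrite linearZl_LR. Qed.

Lemma dotZr a x y : '[x, a *: y] = a^* * '[x, y].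
Proof. by rewrite dot_conj dotZl rmorphM /= -dot_conj. Qed.

Lemma dotDl x y z : '[x + y, z] = '[x, z] + '[y, z].
Proof. by rewrite linearDl. Qed.

Lemma dotDr x y z : '[x, y + z] = '[x, y] + '[x, z].
Proof. by rewrite linearDr. Qed.

Lemma dotBl x y z : '[x - y, z] = '[x, z] - '[y, z].
Proof. by rewrite linearBl. Qed.

Lemma dotBr x y z : '[x, y - z] = '[x, y] - '[x, z].
Proof. by rewrite linearBr. Qed.

Lemma dot_hnorm x : '[x, x] = (hn x ^+ 2)%:C%C.
Proof.
have x0 : 0 <= '[x, x] by exact: dnorm_ge0.
move: x0; rewrite /hnorm; case: '[x, x] => a b.
by rewrite lecE /= => /andP[/eqP-> a0]; rewrite sqr_sqrtr.
Qed.

Lemma hnorm_sqr x : hn x ^+ 2 = complex.Re '[x, x].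
Proof. by rewrite dot_hnorm. Qed.

Lemma hnorm_ge0 x : 0 <= hn x. Proof. exact: sqrtr_ge0. Qed.

Lemma hnorm_eq0 x : hn x = 0 -> x = 0.
Proof.
by move=> x0; apply/eqP; rewrite -(dnorm_eq0 dot) dot_hnorm x0 expr0n.
Qed.

Lemma hnorm0 : hn 0 = 0.
Proof. by rewrite /hnorm linear0r sqrtr0. Qed.

Lemma hnormN x : hn (- x) = hn x.
Proof. by rewrite /hnorm linearNl linearNr /= opprK. Qed.

Lemma eq_hnorm x y : '[x, x] = '[y, y] -> hn x = hn y.
Proof. by rewrite /hnorm => ->. Qed.

Lemma dot_ext x : (forall y, '[x, y] = 0) -> x = 0.
Proof. by move=> x0; apply/eqP; rewrite -(dnorm_eq0 dot) x0. Qed.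

Lemma hnorm_pythagoras x y : '[x, y] = 0 ->
  hn (x + y) ^+ 2 = hn x ^+ 2 + hn y ^+ 2.
Proof.
move=> xy; have yx : '[y, x] = 0 by rewrite dot_conj xy rmorph0.
rewrite !hnorm_sqr dotDl !dotDr xy yx addr0 add0r.
by case: (dot x x) => a b; case: (dot y y) => c d.
Qed.

Lemma hnormZ (a : R) x : 0 <= a -> hn (a%:C%C *: x) = a * hn x.
Proof.
move=> a0; apply/eqP; rewrite -(@eqrXn2 _ 2)// ?mulr_ge0 ?hnorm_ge0//.
rewrite exprMn !hnorm_sqr dotZl dotZr.
by case: (dot x x) => u v /=; apply/eqP; ring.
Qed.

(** Expand the square of the norm of |y|^2 x - <x, y> y. *)
Lemma cauchy_schwarz x y : `|'[x, y]| <= (hn x * hn y)%:C%C.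
Proof.
have [->|y0] := eqVneq y 0; first by rewrite linear0r hnorm0 mulr0 normr0.
have : 0 <= '['[y, y] *: x - '[x, y] *: y, '[y, y] *: x - '[x, y] *: y].
  exact: dnorm_ge0.
rewrite dotBl !dotBr !dotZl !dotZr.
rewrite (dot_conj y x) !dot_hnorm.
have y2 : 0 < hn y ^+ 2.
  by rewrite exprn_gt0// lt_neqAle hnorm_ge0 andbT;
  apply: contra_neq y0 => /esym/hnorm_eq0.
have y2C : (0 : R[i]) < (hn y ^+ 2)%:C%C by rewrite ltcR.
rewrite conj_realC.
set a := (hn x ^+ 2)%:C%C; set b := (hn y ^+ 2)%:C%C; set z := '[x, y].
rewrite [X in 0 <= X](_ : _ = b * (a * b - z * z^* )); last by ring.
rewrite pmulr_rge0// subr_ge0 -normCK => zab.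
rewrite -(@ler_pXn2r _ 2)// ?nnegrE ?normr_ge0 ?lecR ?mulr_ge0 ?hnorm_ge0//.
by rewrite [leRHS](_ : _ = a * b)// /a /b -rmorphM -exprMn rmorphXn.
Qed.

End InnerProduct.

(** * Adjoints and polar decompositions of products with an isometry *)

Section IsometryAdjoint.
Context (R : realType) (H : lmodType R[i]) (dot : {dot H for Num.conj}).
Variables (U V : {linear H -> H}).
Hypotheses (adjUV : forall x y, dot (U x) y = dot x (V y))
           (UK : cancel U V).
Implicit Types (x y z : H) (A B : set (H * H)).

Local Notation "''[' u , v ]" := (dot u v) : ring_scope.
Local Notation hn := (hnorm dot).

Lemma adjVU x y : '[V x, y] = '[x, U y].
Proof. by rewrite dot_conj -adjUV -dot_conj. Qed.

Lemma ocomp_graphr (T : {linear H -> H}) A x y :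
  ocomp A (graph T) (x, y) <-> A (T x, y).
Proof. by split=> [[z]|Axy]; [rewrite /graph /= => -> | exists (T x)]. Qed.

Lemma ocompA A B D : ocomp A (ocomp B D) = ocomp (ocomp A B) D.
Proof.
apply/seteqP; split=> -[x y] /= [z].
  by case=> w Dxw Bwz Azy; exists w => //; exists z.
by move=> Dxz [w Bzw Awy]; exists w => //; exists z.
Qed.

Lemma ocomp_graphK A : ocomp (graph V) (ocomp (graph U) A) = A.
Proof.
apply/seteqP; split=> -[x y] /=.
  by case=> z [w Axw]; rewrite /graph /= => -> ->; rewrite UK.
by move=> Axy; exists (U y) => //=; [exists y|rewrite /graph /= UK].
Qed.

Lemma hnorm_isometry x : hn (U x) = hn x.
Proof. by apply: eq_hnorm; rewrite adjUV UK. Qed.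

Lemma coisometry_defect x : V (x - U (V x)) = 0.
Proof. by rewrite linearB /= UK subrr. Qed.

Lemma coisometry_pythagoras x y :
  hn (U y + (x - U (V x))) ^+ 2 = hn y ^+ 2 + hn (x - U (V x)) ^+ 2.
Proof.
rewrite (@hnorm_pythagoras _ _ _ (U y)) ?hnorm_isometry//.
by rewrite adjUV coisometry_defect linear0r.
Qed.

Lemma hnorm_coisometry x : hn (V x) <= hn x.
Proof.
rewrite -(@ler_pXn2r _ 2)// ?nnegrE ?hnorm_ge0//.
by rewrite -[in leRHS](subrKC (U (V x)) x) coisometry_pythagoras lerDl sqr_ge0.
Qed.

Lemma partial_isometryU : partial_isometry dot U.
Proof.
split=> [|x _]; last exact: hnorm_isometry.
by exists 1 => x; rewrite mul1r hnorm_isometry.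
Qed.

(** The vector x - U (V x) lies in the kernel of V, so a vector orthogonal to this
kernel equals U (V x). *)
Lemma partial_isometryV : partial_isometry dot V.
Proof.
split=> [|x xV]; first by exists 1 => x; rewrite mul1r hnorm_coisometry.
have /eqP : x - U (V x) = 0.
  apply/eqP; rewrite -(dnorm_eq0 dot) dotBl adjUV coisometry_defect.
  by rewrite xV ?coisometry_defect// linear0r subrr.
by rewrite subr_eq0 => /eqP {2}->; rewrite hnorm_isometry.
Qed.

(** Since <U A u, f> = <A u, V f>, a pair (f, g) lies in the adjoint of U A exactly
when (V f, g) lies in the adjoint of A. *)
Lemma adjoint_isometryl A : adjoint dot A = A ->
  adjoint dot (ocomp (graph U) A) = ocomp A (graph V).
Proof.
move=> sA; apply/seteqP; split=> -[f g] /=.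
  move=> fg; apply/ocomp_graphr; rewrite -sA => -[u v] /= Auv.
  by rewrite -adjUV; apply: (fg (u, U v)); exists v.
move=> /ocomp_graphr; rewrite -{1}sA => fg -[u v] /= [w Auw]; rewrite /graph /= => ->.
by rewrite adjUV; exact: (fg (u, w)).
Qed.

(** Testing a pair (f, g) of the adjoint on the range of U gives A f = V g; testing
it on the kernel of V, where A V vanishes, forces g into the range of U. *)
Lemma adjoint_isometryr A : A (0, 0) -> adjoint dot A = A ->
  adjoint dot (ocomp A (graph V)) = ocomp (graph U) A.
Proof.
move=> A0 sA; apply/seteqP; split=> -[f g] /=.
  move=> fg; exists (V g) => /=.
    rewrite -sA => -[u v] /= Auv; rewrite -adjUV.
    by apply: (fg (U u, v)); apply/ocomp_graphr; rewrite UK.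
  have := fg (g - U (V g), 0); rewrite /= linear0l => fg0.
  apply/eqP; rewrite -subr_eq0 -(dnorm_eq0 dot) dotBr -[X in _ - X]adjVU.
  rewrite coisometry_defect linear0l subr0 -fg0//.
  by apply/ocomp_graphr; rewrite coisometry_defect.
case=> w /=; rewrite -{1}sA /graph /= => fw -> -[u v] /ocomp_graphr Auv.
by rewrite /= -adjVU; exact: (fw (_, v)).
Qed.

End IsometryAdjoint.

(** Polarization: equality of norms at x + y and at x + i y determines the two
combinations z + z^* and -i z + i z^* of an inner product z. *)
Lemma isometry_dot (R : realType) (H : lmodType R[i]) (dot : {dot H for Num.conj})
    (U : {linear H -> H}) :
  (forall x, hnorm dot (U x) = hnorm dot x) ->
  forall x y, dot (U x) (U y) = dot x y.
Proof.
move=> isoU x y.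
have iso z : dot (U z) (U z) = dot z z by rewrite !dot_hnorm isoU.
have polar z : dot (U x) (U z) + (dot (U x) (U z))^* = dot x z + (dot x z)^*.
  have := iso (x + z); rewrite linearD /= !dotDl !dotDr !iso.
  rewrite -!addrA => /addrI; rewrite !addrA => /addIr.
  by rewrite (dot_conj _ (U z)) (dot_conj _ z).
have := polar ('i *: y); rewrite linearZ /= !dotZr; move: (polar y).
rewrite !rmorphM /= conjCK conjCi => re.
(* z is recovered from its real part and from the real part of -i z *)
have recover (z : R[i]) :
    z = 2^-1 * ((z + z^*) + 'i * (- 'i * z + 'i * z^*)).
  rewrite [RHS](_ : _ = 2^-1 * (z + z^* + 'i ^+ 2 * (z^* - z))); last by ring.
  by rewrite sqrCi; field.
by move=> im; rewrite [LHS]recover [RHS]recover re im.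
Qed.

(** * Transport of spectral measures by an isometry *)

Section SpectralTransfer.
Context (R : realType) (H : lmodType R[i]) (dot : {dot H for Num.conj}).
Variables (U V : {linear H -> H}).
Hypotheses (adjUV : forall x y, dot (U x) y = dot x (V y))
           (UK : cancel U V).
Implicit Types (x y z : H) (A B : set (H * H)) (M : set (measurableTypeR R)).

Local Notation "''[' u , v ]" := (dot u v) : ring_scope.
Local Notation hn := (hnorm dot).

Section Projection.
Variable E : spectral_measure dot.

(** The spectral projection of U A V when [sproj E M] is the one of A: on the range of
U it is carried over by U, while the orthogonal complement of that range is
annihilated by U A V and therefore belongs to the spectral value 0. *)
Definition transfer_fun M x : H :=
  U (sproj E M (V x)) + (\1_M (0 : R))%:C%C *: (x - U (V x)).

Lemma transfer_fun_linear M : linear (transfer_fun M).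
Proof.
move=> a x y; rewrite /transfer_fun.
rewrite !linearP [in RHS]scalerDr [RHS]addrACA; congr (_ + _).
by rewrite scalerA mulrC -scalerA -scalerDr [a *: (x - _)]scalerDr addrACA.
Qed.

HB.instance Definition _ M :=
  GRing.isLinear.Build R[i] H H *:%R (transfer_fun M) (transfer_fun_linear M).

Lemma coisometry_transfer M x : V (transfer_fun M x) = sproj E M (V x).
Proof.
rewrite /transfer_fun linearD linearZ /= coisometry_defect// scaler0 addr0.
exact: UK.
Qed.

Lemma transfer_idem M : measurable M ->
  forall x, transfer_fun M (transfer_fun M x) = transfer_fun M x.
Proof.
move=> mM x; rewrite {1}/transfer_fun coisometry_transfer sproj_idem//.
congr (_ + _); rewrite /transfer_fun addrC addKr scalerA -rmorphM /=.
by rewrite indicE; case: (_ \in _); rewrite ?mulr1 ?mulr0.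
Qed.

Lemma transfer_selfadj M : measurable M ->
  forall x y, '[transfer_fun M x, y] = '[x, transfer_fun M y].
Proof.
move=> mM x y; rewrite /transfer_fun dotDl dotDr dotZl dotZr dotBl dotBr.
rewrite adjUV sproj_selfadj// -[in RHS](adjVU adjUV) adjUV.
rewrite -[in RHS](adjVU adjUV).
by rewrite conj_realC.
Qed.

Lemma transfer0 x : transfer_fun set0 x = 0.
Proof. by rewrite /transfer_fun sproj0 linear0 indic0 scale0r addr0. Qed.

Lemma transferT x : transfer_fun setT x = x.
Proof. by rewrite /transfer_fun sprojT indicT scale1r subrKC. Qed.

Definition defect_mass x : {nonneg R} := NngNum (sqr_ge0 (hn (x - U (V x)))).

Definition transfer_meas x :=
  measure_add (smeas E (V x)) (mscale (defect_mass x) \d_(0 : measurableTypeR R)).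

Lemma transfer_measE x M :
  (hn (transfer_fun M x) ^+ 2)%:E = transfer_meas x M.
Proof.
have d0 : \d_(0 : measurableTypeR R) M = (\1_M (0 : R))%:E :> \bar R by [].
rewrite /transfer_meas measure_addE /= /mscale [X in (_ * X)%E]d0 -EFinM -EFinD.
congr _%:E; rewrite /transfer_fun indicE; case: (_ \in _) => /=.
  by rewrite scale1r coisometry_pythagoras// mulr1.
by rewrite scale0r addr0 (hnorm_isometry adjUV)// mulr0 addr0.
Qed.

Lemma transfer_sigma_additive x :
  semi_sigma_additive (fun M => (hn (transfer_fun M x) ^+ 2)%:E).
Proof.
rewrite (_ : (fun M => _) = transfer_meas x); last first.
  by apply/funext => M; exact: transfer_measE.
exact: measure_semi_sigma_additive.
Qed.

Definition transfer : spectral_measure dot :=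
  SpectralMeasure transfer_idem transfer_selfadj transfer0 transferT
    transfer_sigma_additive.

(** The two scalar measures differ by an atom at 0, where g vanishes. *)
Lemma ge0_integral_transfer (x : H) (g : R -> R) :
  measurable_fun setT g -> (forall r, 0 <= g r) -> g 0 = 0 ->
  (\int[smeas transfer x]_r (g r)%:E = \int[smeas E (V x)]_r (g r)%:E)%E.
Proof.
move=> mg g0 g00.
have mG : measurable_fun setT (fun r : measurableTypeR R => (g r)%:E).
  exact/measurable_EFinP.
have G0 r : setT r -> (0 <= (g r)%:E)%E by rewrite lee_fin.
rewrite (eq_measure_integral (transfer_meas x)); last first.
  by move=> M mM _; exact: transfer_measE.
rewrite ge0_integral_measure_add// ge0_integral_mscale// integral_dirac//.
by rewrite g00 mule0 mule0 adde0.
Qed.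

Lemma Rintegral_transfer (x : H) (g : R -> R) :
  measurable_fun setT g -> g 0 = 0 ->
  \int[smeas transfer x]_r (g r) = \int[smeas E (V x)]_r (g r).
Proof.
move=> mg g0; rewrite /Rintegral; congr fine.
rewrite [LHS]integralE [RHS]integralE funerpos funerneg /=; congr (_ - _)%E.
  apply: (@ge0_integral_transfer x g^\+%R); first exact: measurable_funrpos.
    exact: funrpos_ge0.
  by rewrite /funrpos /= g0 maxxx.
apply: (@ge0_integral_transfer x g^\-%R); first exact: measurable_funrneg.
  exact: funrneg_ge0.
by rewrite /funrneg /= g0 oppr0 maxxx.
Qed.

End Projection.

Lemma is_operator_transfer A : is_operator A ->
  is_operator (ocomp (graph U) (ocomp A (graph V))).
Proof.
case=> A0 Alin Afun; split=> [|a [x y] [x' y']|x y y'] /=.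
- by exists 0; [apply/ocomp_graphr; rewrite linear0|rewrite /graph /= linear0].
- case=> w /ocomp_graphr Axw; rewrite /graph /= => ->.
  case=> w' /ocomp_graphr Axw'; rewrite /graph /= => ->.
  exists (a *: w + w'); last by rewrite /= linearP.
  by apply/ocomp_graphr; rewrite linearP; exact: (Alin _ (_, _) (_, _)).
- case=> w /ocomp_graphr Axw; rewrite /graph /= => ->.
  by case=> w' /ocomp_graphr /(Afun _ _ _ Axw) <-; rewrite /graph /= => ->.
Qed.

Lemma transfer_spectral_integral E (g : R -> R) A :
  measurable_fun setT g -> g 0 = 0 -> is_spectral_integral E g A ->
  is_spectral_integral (transfer E) g (ocomp (graph U) (ocomp A (graph V))).
Proof.
move=> mg g0 [opA domA formA]; split; first exact: is_operator_transfer.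
  have domE x : (exists y, A (V x, y)) <->
      (\int[smeas (transfer E) x]_r ((g r) ^+ 2)%:E < +oo)%E.
    rewrite (@ge0_integral_transfer E x (fun r => g r ^+ 2)).
    - have : dom A (V x) <-> (\int[smeas E (V x)]_r ((g r) ^+ 2)%:E < +oo)%E.
        by rewrite domA.
      by [].
    - exact: measurable_funX.
    - by move=> r; exact: sqr_ge0.
    - by rewrite g0 expr0n.
  apply/seteqP; split=> x /=.
    by move=> [y [w /ocomp_graphr Axw _]]; apply/domE; exists w.
  move=> /domE[w Axw]; exists (U w), w => //.
  exact/ocomp_graphr.
move=> x y [w /ocomp_graphr Axw]; rewrite /graph /= => ->.
by rewrite adjUV (formA _ _ Axw) Rintegral_transfer.
Qed.

(** The exponent 0 has to be excluded: the zeroth power of U A V is the identity,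
whereas U V is only the projection onto the range of U. *)
Lemma transfer_power A B t : t != 0 -> is_power dot A t B ->
  is_power dot (ocomp (graph U) (ocomp A (graph V))) t
               (ocomp (graph U) (ocomp B (graph V))).
Proof.
move=> t0 [E [E0 EA EB]]; exists (transfer E); split=> [x||].
- rewrite /= /transfer_fun E0 indicE mem_set ?scale1r ?subrKC//=.
  by rewrite in_itv/= lexx.
- exact: transfer_spectral_integral.
- apply: transfer_spectral_integral => //; last exact: powR0.
Qed.

End SpectralTransfer.

(** * Aluthge transforms of U A and of A V *)

Section Aluthge.
Context (R : realType) (H : lmodType R[i]) (dot : {dot H for Num.conj}).
Variables (U V : {linear H -> H}).
Hypotheses (adjUV : forall x y, dot (U x) y = dot x (V y))
           (UK : cancel U V).
Variable A : set (H * H).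
Hypotheses (opA : is_operator A) (selfadjA : adjoint dot A = A)
           (powA : is_power dot (ocomp A A) 2^-1 A) (kerA : oker A = [set 0]).

Let A0 : A (0, 0). Proof. by case: opA. Qed.

(** The modulus is the square root of (U A)^* (U A) = A V U A = A A. *)
Lemma polar_isometry : is_polar dot (ocomp (graph U) A) U A.
Proof.
split=> //.
- rewrite /is_modulus (adjoint_isometryl adjUV)// -ocompA.
  by rewrite ocomp_graphK.
- exact: partial_isometryU adjUV UK.
apply/seteqP; split=> x /=.
  move=> /(congr1 V); rewrite UK linear0 => ->.
  by exists 0 => //; rewrite /graph /= linear0.
case=> y Axy; rewrite /graph /= => /(congr1 V); rewrite UK linear0 => y0.
have : oker A x by rewrite /oker /= y0.
by rewrite kerA => /= ->; rewrite linear0.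
Qed.

(** Here (A V)^* (A V) = U A A V, whose square root is obtained from that of A A by
transport along U. *)
Lemma polar_coisometry : is_polar dot (ocomp A (graph V)) V
  (ocomp (graph U) (ocomp A (graph V))).
Proof.
split.
- rewrite /is_modulus (adjoint_isometryr adjUV)//.
  have := transfer_power adjUV UK _ powA; rewrite -!ocompA; apply.
  by rewrite invr_eq0 pnatr_eq0.
- exact: partial_isometryV adjUV UK.
- apply/seteqP; split=> x /=.
    by move=> Vx0; apply/ocomp_graphr; rewrite Vx0.
  by move=> /ocomp_graphr Ax; have : oker A (V x) by []; rewrite kerA.
- by rewrite ocomp_graphK.
Qed.

Lemma aluthge_isometry t B B' : is_power dot A t B -> is_power dot A (1 - t) B' ->
  is_aluthge dot t (ocomp (graph U) A) (ocomp B (ocomp (graph U) B')).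
Proof. by move=> AB AB'; exists U, A, B, B'; split=> //; exact: polar_isometry. Qed.

(** In (U B V) V (U B' V) the middle factor V U cancels. *)
Lemma aluthge_coisometry t B B' : 0 < t < 1 ->
  is_power dot A t B -> is_power dot A (1 - t) B' ->
  is_aluthge dot t (ocomp A (graph V))
    (ocomp (graph U) (ocomp B (ocomp (graph V) (ocomp B' (graph V))))).
Proof.
move=> /andP[t0 t1] AB AB'.
exists V, (ocomp (graph U) (ocomp A (graph V))),
  (ocomp (graph U) (ocomp B (graph V))), (ocomp (graph U) (ocomp B' (graph V))).
split; first exact: polar_coisometry.
- by apply: transfer_power => //; rewrite gt_eqF.
- by apply: transfer_power => //; rewrite gt_eqF// subr_gt0.
- by rewrite ocomp_graphK// !ocompA.
Qed.

End Aluthge.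

(** * Square summable functions on a discrete measure space *)

Section AtomicMeasure.
Context d (T : measurableType d) (R : realType).
Variables (w : nat -> {nonneg R}) (a : nat -> T).

Definition atomic : {measure set T -> \bar R} :=
  mseries (fun n => mscale (w n) \d_(a n)) 0.

Lemma ge0_integral_atomic (f : T -> \bar R) : measurable_fun setT f ->
  (forall x, (0 <= f x)%E) ->
  (\int[atomic]_x f x = \sum_(0 <= n <oo) (w n)%:num%:E * f (a n))%E.
Proof.
move=> mf f0; rewrite ge0_integral_measure_series//.
apply: eq_eseriesr => n _.
rewrite ge0_integral_mscale// integral_dirac//.
by rewrite diracT mul1e.
Qed.

Lemma atomicE (A : set T) :
  (atomic A = \sum_(0 <= n <oo) ((w n)%:num * \1_A (a n))%:E)%E.
Proof. by []. Qed.

End AtomicMeasure.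

Lemma nneseries_single (R : realType) (f : nat -> \bar R) n :
  (0 <= f n)%E -> (forall k, k != n -> f k = 0%E) ->
  (\sum_(0 <= k <oo) f k = f n)%E.
Proof.
move=> fn0 f0; rewrite (@nneseriesD1 _ _ n)//; last first.
  by move=> k _; have [->|/f0->] := eqVneq k n.
by rewrite eseries0 ?adde0// => k _ /andP[_ /f0].
Qed.

Section DiscreteL2.
Context (R : realType) (m : nat -> {posnum R}).

Definition discrete_measure : {measure set nat -> \bar R} :=
  atomic (fun n => (m n)%:num%:nng) id.
Local Notation mu := discrete_measure.
Local Notation H := (L2 mu).
Local Notation hn := (hnorm (L2inner mu)).
Implicit Types (F G : H) (f g : nat -> R[i]).

Definition sumsq f : \bar R := (\sum_(0 <= n <oo) ((m n)%:num * sqmod (f n))%:E)%E.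

Lemma integral_sqmod f : (\int[mu]_x (sqmod (f x))%:E = sumsq f)%E.
Proof.
by rewrite ge0_integral_atomic// => n; rewrite lee_fin sqmod_ge0.
Qed.

Lemma L2pred_natP f : f \in L2pred mu <-> (sumsq f < +oo)%E.
Proof.
rewrite -integral_sqmod; split=> [/L2predP[]//|foo].
by apply/L2predP; split.
Qed.

Lemma discrete_measure1 n : mu [set n] = (m n)%:num%:E.
Proof.
rewrite atomicE (@nneseries_single _ _ n).
- by rewrite /= indicE mem_set// mulr1.
- by rewrite lee_fin mulr_ge0.
- by move=> k kn; rewrite /= indicE memNset ?mulr0//; exact/eqP.
Qed.

(** Every point has positive mass, so only the empty set is negligible. Elements of
L^2 are therefore determined by their values, not merely almost everywhere. *)
Lemma ae_discreteP (P : nat -> Prop) : {ae mu, forall n, P n} <-> forall n, P n.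
Proof.
split=> [[A [mA A0 PA]] n|Pn]; last exact: aeW.
apply: contrapT => nPn; have An : [set n] `<=` A by move=> _ ->; exact: PA.
have : (mu [set n] <= mu A)%E by apply: le_measure => //; rewrite inE.
by rewrite A0 discrete_measure1 lee_fin leNgt gt0.
Qed.

Lemma L2rep_pi (f : L2fun mu) n : L2rep (\pi_(L2 mu) f) n = f n.
Proof.
by have /eqP/L2_eqP/ae_discreteP := reprK (\pi_(L2 mu) f); apply.
Qed.

Lemma L2_ext F G : (forall n, L2rep F n = L2rep G n) -> F = G.
Proof.
move=> FG; rewrite -[F]reprK -[G]reprK; apply/eqP/L2_eqP/ae_discreteP.
exact: FG.
Qed.

Lemma L2repD F G n : L2rep (F + G) n = L2rep F n + L2rep G n.
Proof.
rewrite -{1}[F]reprK -{1}[G]reprK -pi_L2D L2rep_pi.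
by [].
Qed.

Lemma L2repZ a F n : L2rep (a *: F) n = a * L2rep F n.
Proof. by rewrite -{1}[F]reprK -pi_L2Z L2rep_pi. Qed.

Lemma L2rep0 n : L2rep (0 : H) n = 0.
Proof. by rewrite -(scale0r (0 : H)) L2repZ mul0r. Qed.

Lemma L2repN F n : L2rep (- F) n = - L2rep F n.
Proof. by rewrite -scaleN1r L2repZ mulN1r. Qed.

Lemma L2repB F G n : L2rep (F - G) n = L2rep F n - L2rep G n.
Proof. by rewrite L2repD L2repN. Qed.

Lemma sumsq_L2rep F : (sumsq (L2rep F) < +oo)%E.
Proof. exact/L2pred_natP/L2valP. Qed.

(** The element of L^2 with prescribed values; nothing is said about it when these
values are not square summable. *)
Fact ofun_subproof f :
  {F : H | (sumsq f < +oo)%E -> forall n, L2rep F n = f n}.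
Proof.
exists (\pi_(L2 mu) (insubd (0 : L2fun mu) f)) => /L2pred_natP foo n.
by rewrite L2rep_pi insubdK.
Qed.

Definition ofun f : H := sval (ofun_subproof f).

Lemma ofunE f n : (sumsq f < +oo)%E -> L2rep (ofun f) n = f n.
Proof. by move=> foo; rewrite /ofun; case: ofun_subproof => F /= ->. Qed.

Lemma sumsq_ge0 f : (0 <= sumsq f)%E.
Proof. by apply: nneseries_ge0 => n _ _; rewrite lee_fin mulr_ge0// sqmod_ge0. Qed.

Lemma L2innerE F G :
  L2inner mu F G = cintegral mu (fun n => L2rep F n * (L2rep G n)^*).
Proof. by []. Qed.

Lemma hnorm_sumsq F : (hn F ^+ 2)%:E = sumsq (L2rep F).
Proof.
rewrite hnorm_sqr L2innerE /cintegral /=.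
rewrite (_ : (fun _ => _) = (fun n => sqmod (L2rep F n))); last first.
  apply/funext => n; case: (L2rep F n) => a b.
  by rewrite /sqmod/= mulrN opprK -!expr2.
rewrite /Rintegral fineK integral_sqmod//.
by rewrite ge0_fin_numE ?sumsq_ge0// sumsq_L2rep.
Qed.

Lemma sqmod_le_hnorm F n : (m n)%:num * sqmod (L2rep F n) <= hn F ^+ 2.
Proof.
rewrite -lee_fin hnorm_sumsq /sumsq (@nneseriesD1 _ _ n)//; last first.
  by move=> k _; rewrite lee_fin mulr_ge0// sqmod_ge0.
rewrite leeDl// nneseries_ge0// => k _ _.
by rewrite lee_fin mulr_ge0// sqmod_ge0.
Qed.

Definition delta n : H := ofun (fun k => (k == n)%:R).

Lemma sumsq_delta n : sumsq (fun k => (k == n)%:R) = (m n)%:num%:E.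
Proof.
rewrite /sumsq (@nneseries_single _ _ n).
- by rewrite eqxx /sqmod /= expr1n expr0n addr0 mulr1.
- by rewrite lee_fin mulr_ge0// sqmod_ge0.
- by move=> k /negPf->; rewrite /sqmod /= expr0n addr0 mulr0.
Qed.

Lemma deltaE n k : L2rep (delta n) k = (k == n)%:R.
Proof. by rewrite ofunE// sumsq_delta ltry. Qed.

Lemma hnorm_delta n : hn (delta n) ^+ 2 = (m n)%:num.
Proof.
apply: EFin_inj; rewrite hnorm_sumsq -sumsq_delta; congr sumsq.
by apply/funext => k; rewrite deltaE.
Qed.

Lemma Rintegral_single (h : nat -> R) n : (forall k, k != n -> h k = 0) ->
  \int[mu]_k h k = (m n)%:num * h n.
Proof.
move=> h0; rewrite /Rintegral.
rewrite (_ : (fun k => (h k)%:E) = (cst (h n)%:E) \_ [set n]); last first.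
  apply/funext => k; rewrite patchE; case: ifPn => [/set_mem -> //|].
  by move=> /negP kn; rewrite h0//; apply/eqP => kE; apply: kn; rewrite kE mem_set.
rewrite -integral_mkcond integral_cst// [X in (_ * X)%E]discrete_measure1.
by rewrite -EFinM mulrC.
Qed.

Lemma dot_delta F n : L2inner mu F (delta n) = (m n)%:num%:C%C * L2rep F n.
Proof.
rewrite L2innerE /cintegral !(@Rintegral_single _ n).
- rewrite deltaE eqxx; case: (L2rep F n) => a b /=.
  by apply/eqP; rewrite eq_complex /=; apply/andP; split; apply/eqP; ring.
- by move=> k /negPf kn; rewrite deltaE kn rmorph0 mulr0.
- by move=> k /negPf kn; rewrite deltaE kn rmorph0 mulr0.
Qed.

End DiscreteL2.

(** * Multiplication operators and their powers *)

Section MultiplicationOperators.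
Context (R : realType) (m : nat -> {posnum R}).
Local Notation mu := (discrete_measure m).
Local Notation H := (L2 mu).
Local Notation hn := (hnorm (L2inner mu)).
Implicit Types (F G : H) (g k : nat -> R).

Definition mulop g : set (H * H) :=
  [set p | forall n, L2rep p.2 n = (g n)%:C%C * L2rep p.1 n].

Lemma mulopE g F G : mulop g (F, G) <->
  forall n, L2rep G n = (g n)%:C%C * L2rep F n.
Proof. by []. Qed.

Lemma sqmodZ (r : R) (z : R[i]) : sqmod (r%:C%C * z) = r ^+ 2 * sqmod z.
Proof. by rewrite sqmodM /sqmod /= expr0n addr0. Qed.

Lemma dom_mulop g F : dom (mulop g) F <->
  (\sum_(0 <= n <oo) ((m n)%:num * ((g n) ^+ 2 * sqmod (L2rep F n)))%:E < +oo)%E.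
Proof.
have sE : (\sum_(0 <= n <oo) ((m n)%:num * ((g n) ^+ 2 * sqmod (L2rep F n)))%:E
    = sumsq m (fun n => (g n)%:C%C * L2rep F n)%R)%E.
  by apply: eq_eseriesr => n _; rewrite sqmodZ.
rewrite sE; split=> [[G /mulopE FG]|foo].
  rewrite (_ : (fun _ => _) = L2rep G); first exact: sumsq_L2rep.
  by apply/funext => n; rewrite FG.
by exists (ofun m (fun n => (g n)%:C%C * L2rep F n)) => n; rewrite ofunE.
Qed.

Lemma is_operator_mulop g : is_operator (mulop g).
Proof.
split=> [n|a [x y] [x' y'] /= xy xy' n|x y y' xy xy'].
- by rewrite !L2rep0 mulr0.
- by rewrite !L2repD !L2repZ xy xy' mulrDr mulrCA.
- by apply: L2_ext => n; rewrite xy xy'.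
Qed.

Lemma sumsq_lty_le (f : nat -> R[i]) (a : nat -> R) :
  (forall n, sqmod (f n) <= a n) ->
  (\sum_(0 <= n <oo) ((m n)%:num * a n)%:E < +oo)%E -> (sumsq m f < +oo)%E.
Proof.
move=> fa; apply: le_lt_trans; apply: lee_nneseries => [i _ _|i _].
  by rewrite lee_fin mulr_ge0// sqmod_ge0.
by rewrite lee_fin ler_pM2l.
Qed.

(** The domains agree because k^2 <= 1 + k^4: if f and k^2 f are square summable, then
so is k f. *)
Lemma ocomp_mulop k : ocomp (mulop k) (mulop k) = mulop (fun n => k n * k n).
Proof.
apply/seteqP; split=> -[F G].
  by case=> F' /= FF' F'G n; rewrite F'G FF' mulrA rmorphM.
move=> FG; pose F' := ofun m (fun n => (k n)%:C%C * L2rep F n).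
have FF' n : L2rep F' n = (k n)%:C%C * L2rep F n.
  rewrite ofunE//.
  apply: (@sumsq_lty_le _ (fun n => sqmod (L2rep F n) + sqmod (L2rep G n))).
    move=> i; rewrite FG !sqmodZ.
    rewrite [leRHS](_ : _ = (1 + (k i * k i) ^+ 2) * sqmod (L2rep F i)); last by ring.
    apply: ler_wpM2r; first exact: sqmod_ge0.
    have := sqr_ge0 (k i * k i - 1); have := sqr_ge0 (k i); rewrite !expr2; nra.
  under eq_eseriesr do rewrite mulrDr EFinD.
  rewrite nneseriesD; last 2 first.
  - by move=> i _; rewrite lee_fin mulr_ge0// sqmod_ge0.
  - by move=> i _; rewrite lee_fin mulr_ge0// sqmod_ge0.
  by rewrite lte_add_pinfty//; exact: sumsq_L2rep.
exists F' => // n.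
by rewrite FG FF' mulrA rmorphM.
Qed.

Lemma delta_mulop g n : mulop g (delta m n, (g n)%:C%C *: delta m n).
Proof.
move=> k; rewrite L2repZ !deltaE.
by case: eqVneq => [->//|_]; rewrite !mulr0.
Qed.

(** Testing a pair of the adjoint on the indicators of points determines it pointwise. *)
Lemma adjoint_mulop g : adjoint (L2inner mu) (mulop g) = mulop g.
Proof.
apply/seteqP; split=> -[F G].
  move=> FG n; have := FG (_, _) (delta_mulop g n).
  rewrite /= dotZl !(dot_conj _ (delta m n)) !dot_delta !rmorphM /=.
  rewrite !conj_realC mulrCA => h.
  have mn0 : (m n)%:num%:C%C != 0 :> R[i] by rewrite eq_complex /= eqxx andbT.
  apply: (can_inj (@conjCK _)); apply: (mulfI mn0).
  by rewrite -h rmorphM /= conj_realC.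
move=> FG [F' G'] FG'; rewrite !L2innerE; congr cintegral; apply/funext => n.
rewrite /= FG FG' rmorphM /= conj_realC.
by rewrite -mulrA mulrCA.
Qed.

Section SpectralMeasure.
Variable k : nat -> R.
Implicit Type M : set (measurableTypeR R).

(** The spectral projection, for the set M, of the multiplication by k. *)
Definition cut_fun M F : H := ofun m (fun n => (\1_M (k n))%:C%C * L2rep F n).

Lemma cutE M F n : L2rep (cut_fun M F) n = (\1_M (k n))%:C%C * L2rep F n.
Proof.
rewrite ofunE//; apply: le_lt_trans (sumsq_L2rep F).
apply: lee_nneseries => [i _ _|i _].
  by rewrite lee_fin mulr_ge0// sqmod_ge0.
rewrite lee_fin ler_pM2l// sqmodZ ler_piMl ?sqmod_ge0//.
Qed.

Lemma cut_linear M : linear (cut_fun M).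
Proof.
move=> a F G; apply: L2_ext => n.
by rewrite !(L2repD, L2repZ, cutE) mulrDr mulrCA.
Qed.

HB.instance Definition _ M :=
  GRing.isLinear.Build R[i] H H *:%R (cut_fun M) (cut_linear M).

Lemma cut_idem M : measurable M ->
  forall F, cut_fun M (cut_fun M F) = cut_fun M F.
Proof.
move=> _ F; apply: L2_ext => n; rewrite !cutE mulrA -rmorphM /=.
by rewrite indicE; case: (_ \in _); rewrite ?mulr1 ?mulr0.
Qed.

Lemma cut_selfadj M : measurable M -> forall F G,
  L2inner mu (cut_fun M F) G = L2inner mu F (cut_fun M G).
Proof.
move=> _ F G; rewrite !L2innerE; congr cintegral; apply/funext => n.
rewrite !cutE rmorphM /= conj_realC.
by rewrite -mulrA mulrCA.
Qed.

Lemma cut0 F : cut_fun set0 F = 0.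
Proof. by apply: L2_ext => n; rewrite cutE indic0 mul0r L2rep0. Qed.

Lemma cutT F : cut_fun setT F = F.
Proof. by apply: L2_ext => n; rewrite cutE indicT mul1r. Qed.

Definition mass F n : {nonneg R} :=
  NngNum (mulr_ge0 (ge0 (m n)) (sqmod_ge0 (L2rep F n))).

(** The scalar spectral measure at F: the image under k of the measure of density
|F|^2. *)
Definition cut_meas F := atomic (mass F) (k : nat -> measurableTypeR R).

Lemma cut_measE F M : (hn (cut_fun M F) ^+ 2)%:E = cut_meas F M.
Proof.
rewrite hnorm_sumsq /cut_meas atomicE; apply: eq_eseriesr => n _.
rewrite cutE sqmodZ /= indicE.
by case: (_ \in _); rewrite ?expr1n ?expr0n ?mul1r ?mulr1 ?mul0r ?mulr0.
Qed.

Lemma cut_sigma_additive F :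
  semi_sigma_additive (fun M => (hn (cut_fun M F) ^+ 2)%:E).
Proof.
rewrite (_ : (fun M => _) = cut_meas F).
  exact: measure_semi_sigma_additive.
by apply/funext => M; exact: cut_measE.
Qed.

Definition cut : spectral_measure (L2inner mu) :=
  SpectralMeasure cut_idem cut_selfadj cut0 cutT cut_sigma_additive.

Lemma ge0_integral_cut F (g : R -> R) :
  measurable_fun setT g -> (forall r, 0 <= g r) ->
  (\int[smeas cut F]_r (g r)%:E =
   \sum_(0 <= n <oo) ((m n)%:num * (g (k n) * sqmod (L2rep F n)))%:E)%E.
Proof.
move=> mg g0.
have mG : measurable_fun setT (fun r : measurableTypeR R => (g r)%:E).
  exact/measurable_EFinP.
rewrite (eq_measure_integral (cut_meas F)); last first.
  by move=> M mM _; exact: cut_measE.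
rewrite ge0_integral_atomic//.
apply: eq_eseriesr => n _ /=; rewrite -EFinM; congr _%:E.
by rewrite -mulrA; congr *%R; rewrite mulrC.
Qed.

Lemma Rintegral_cut F (g : R -> R) : measurable_fun setT g ->
  \int[smeas cut F]_r g r = \int[mu]_n (g (k n) * sqmod (L2rep F n)).
Proof.
move=> mg; rewrite /Rintegral; congr fine.
have E (h : R -> R) : measurable_fun setT h -> (forall r, 0 <= h r) ->
    (\int[smeas cut F]_r (h r)%:E = \int[mu]_n (h (k n) * sqmod (L2rep F n))%:E)%E.
  move=> mh h0; rewrite ge0_integral_cut// ge0_integral_atomic//.
  by move=> n; rewrite lee_fin mulr_ge0// sqmod_ge0.
rewrite [LHS]integralE [RHS]integralE !funerpos !funerneg /=; congr (_ - _)%E.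
  rewrite (E g^\+%R); [|exact: measurable_funrpos|exact: funrpos_ge0].
  apply: eq_integral => n _; congr _%:E.
  by rewrite /funrpos /= maxr_pMl ?sqmod_ge0// mul0r.
rewrite (E g^\-%R); [|exact: measurable_funrneg|exact: funrneg_ge0].
apply: eq_integral => n _; congr _%:E.
by rewrite /funrneg /= maxr_pMl ?sqmod_ge0// mul0r mulNr.
Qed.

Lemma cut_spectral_integral (g : R -> R) : measurable_fun setT g ->
  is_spectral_integral cut g (mulop (g \o k)).
Proof.
move=> mg; split; first exact: is_operator_mulop.
  apply/seteqP; split=> F /=; rewrite ge0_integral_cut.
  - by move/dom_mulop.
  - exact: measurable_funX.
  - by move=> r; exact: sqr_ge0.
  - by move=> h; apply/dom_mulop.
  - exact: measurable_funX.
  - by move=> r; exact: sqr_ge0.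
move=> F G FG; rewrite Rintegral_cut// L2innerE /cintegral.
have E n : L2rep G n * (L2rep F n)^* = (g (k n) * sqmod (L2rep F n))%:C%C.
  rewrite FG -mulrA rmorphM; congr (_ * _) => /=.
  case: (L2rep F n) => a b; apply/eqP; rewrite eq_complex /sqmod /=.
  by apply/andP; split; apply/eqP; ring.
congr (_ +i* _)%C; first by apply: eq_Rintegral => n _; rewrite E.
rewrite (_ : (fun n => _) = cst 0) ?Rintegral_cst ?mul0r//.
by apply/funext => n; rewrite E.
Qed.

End SpectralMeasure.

(** The multiplication by k and its powers are the integrals of r and of r^t with
respect to the spectral measure [cut]. *)
Lemma mulop_power k t : (forall n, 0 <= k n) ->
  is_power (L2inner mu) (mulop k) t (mulop (fun n => k n `^ t)).
Proof.
move=> k0; exists (cut k); split=> [F||].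
- by apply: L2_ext => n; rewrite /= cutE indicE mem_set ?mul1r//= in_itv/= k0.
- exact: (@cut_spectral_integral k id).
- apply: (@cut_spectral_integral k (fun r => r `^ t)).
  exact: measurable_powR.
Qed.

End MultiplicationOperators.

(** * Finite truncations and the adjoint of an isometry *)

Section Truncation.
Context (R : realType) (m : nat -> {posnum R}).
Local Notation mu := (discrete_measure m).
Local Notation H := (L2 mu).
Local Notation hn := (hnorm (L2inner mu)).
Implicit Types (F G : H) (f g : nat -> R[i]).

Definition trunc N f : H := \sum_(n < N) f n *: delta m n.

Lemma truncE N f n : L2rep (trunc N f) n = if (n < N)%N then f n else 0.
Proof.
elim: N => [|N IH]; first by rewrite /trunc big_ord0 L2rep0.
rewrite /trunc big_ord_recr /= L2repD -/(trunc N f) IH L2repZ deltaE ltnS.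
rewrite [(n <= N)%N]leq_eqVlt; case: (eqVneq n N) => [->|_] /=.
  by rewrite ltnn add0r mulr1.
by rewrite mulr0 addr0.
Qed.

Lemma dot_truncr N F f : L2inner mu F (trunc N f) =
  \sum_(n < N) (f n)^* * L2inner mu F (delta m n).
Proof.
rewrite /trunc linear_sumr /=; apply: eq_bigr => n _.
by rewrite dotZr.
Qed.

Lemma hnorm_trunc N f :
  hn (trunc N f) ^+ 2 = \sum_(n < N) (m n)%:num * sqmod (f n).
Proof.
apply: EFin_inj; rewrite hnorm_sumsq /sumsq (nneseries_split _ N); last first.
  by move=> k _; rewrite lee_fin mulr_ge0// sqmod_ge0.
rewrite add0n [X in (_ + X)%E]eseries0 ?adde0; last first.
  move=> k kN _; rewrite truncE ltnNge kN.
  by rewrite /sqmod /= expr0n addr0 mulr0.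
rewrite big_mkord sumEFin; congr _%:E; apply: eq_bigr => n _.
by rewrite truncE ltn_ord.
Qed.

(** The tails of a convergent series tend to 0. *)
Lemma trunc_approx F (e : R) : 0 < e -> exists N, hn (F - trunc N (L2rep F)) < e.
Proof.
move=> e0; set u := fun n => ((m n)%:num * sqmod (L2rep F n))%:E.
have u0 n : (0 <= u n)%E by rewrite lee_fin mulr_ge0// sqmod_ge0.
have := nneseries_tail_cvg (sumsq_L2rep F) (fun n _ => u0 n).
have e2 : (0 < (e ^+ 2)%:E)%E by rewrite lte_fin exprn_gt0.
move=> /(_ _ (open_ereal_lt' e2))[N _ /(_ N (leqnn N))] /= uN; exists N.
rewrite -(@ltr_pXn2r _ 2)// ?nnegrE ?hnorm_ge0 ?ltW// -lte_fin.
apply: le_lt_trans uN; rewrite hnorm_sumsq /sumsq (nneseries_split _ N); last first.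
  by move=> k _; rewrite lee_fin mulr_ge0// sqmod_ge0.
rewrite add0n big_nat big1 ?add0e => [|k /andP[_ kN]]; last first.
  by rewrite L2repB truncE kN subrr /sqmod /= expr0n addr0 mulr0.
apply: lee_nneseries => [k _ _|k _].
  by rewrite lee_fin mulr_ge0// sqmod_ge0.
rewrite lee_fin ler_pM2l// L2repB truncE.
case: ifPn => _; last by rewrite subr0.
by rewrite subrr {1}/sqmod /= expr0n addr0 sqmod_ge0.
Qed.

Section AdjointOfIsometry.
Variable U : {linear H -> H}.
Hypothesis isoU : forall F, hn (U F) = hn F.

(** The Fourier coefficient of G along the orthogonal family U (delta n); it turns out
to be the value at n of the adjoint of U at G. *)
Definition coord G n := (m n)%:num%:C%C^-1 * L2inner mu G (U (delta m n)).

Lemma coordE G n : L2inner mu G (U (delta m n)) = (m n)%:num%:C%C * coord G n.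
Proof. by rewrite /coord mulVKf// eq_complex /= eqxx andbT. Qed.

Lemma dot_isometry_trunc G N f : L2inner mu G (U (trunc N f)) =
  \sum_(n < N) (f n)^* * ((m n)%:num%:C%C * coord G n).
Proof.
rewrite /trunc linear_sum linear_sumr /=; apply: eq_bigr => n _.
by rewrite linearZ /= dotZr coordE.
Qed.

(** Let P be the combination of the indicators of the first N points with the
coefficients of G. Then <G, U P> = |P|^2, and Cauchy-Schwarz gives |P| <= |G|. *)
Lemma bessel G N : \sum_(n < N) (m n)%:num * sqmod (coord G n) <= hn G ^+ 2.
Proof.
set P := trunc N (coord G); rewrite -hnorm_trunc -/P.
have : L2inner mu G (U P) = (hn P ^+ 2)%:C%C.
  rewrite dot_isometry_trunc hnorm_trunc rmorph_sum /=; apply: eq_bigr => n _.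
  case: (coord G n) => a b; apply/eqP; rewrite eq_complex /sqmod /=.
  by apply/andP; split; apply/eqP; ring.
move=> GP; have := cauchy_schwarz (L2inner mu) G (U P).
rewrite GP isoU ger0_norm ?lecR ?sqr_ge0// expr2.
have [->|P0] := eqVneq (hn P) 0; first by rewrite mulr0 sqr_ge0.
rewrite ler_pM2r ?lt_neqAle ?hnorm_ge0 1?eq_sym ?P0// => PG.
by rewrite -expr2 ler_pXn2r ?nnegrE ?hnorm_ge0.
Qed.

Lemma sumsq_coord G : (sumsq m (coord G) < +oo)%E.
Proof.
apply: (@le_lt_trans _ _ (hn G ^+ 2)%:E); last exact: ltry.
apply: lime_le.
  by apply: is_cvg_nneseries => n _ _; rewrite lee_fin mulr_ge0// sqmod_ge0.
by apply: nearW => N; rewrite big_mkord sumEFin lee_fin bessel.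
Qed.

Fact isometry_adjoint_subproof G : {F : H | forall n, L2rep F n = coord G n}.
Proof. by exists (ofun m (coord G)) => n; rewrite ofunE// sumsq_coord. Qed.

Definition isometry_adjoint G : H := sval (isometry_adjoint_subproof G).

Lemma isometry_adjointE G n : L2rep (isometry_adjoint G) n = coord G n.
Proof. exact: (svalP (isometry_adjoint_subproof G)). Qed.

Lemma isometry_adjoint_linear : linear isometry_adjoint.
Proof.
move=> a F G; apply: L2_ext => n.
rewrite isometry_adjointE L2repD L2repZ !isometry_adjointE /coord dotDl dotZl.
by rewrite mulrDr mulrCA.
Qed.

HB.instance Definition _ :=
  GRing.isLinear.Build R[i] H H *:%R isometry_adjoint isometry_adjoint_linear.

(** Both sides are continuous in F and agree on finitely supported functions, which
are dense. *)
Lemma isometry_adjointP F G :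
  L2inner mu (U F) G = L2inner mu F (isometry_adjoint G).
Proof.
apply: (can_inj (@conjCK _)); rewrite -!dot_conj; apply/eqP; rewrite -subr_eq0.
set z := _ - _; have [//|z0] := eqVneq z 0; exfalso.
pose c := 1 + hn G + hn (isometry_adjoint G).
have hG := hnorm_ge0 (L2inner mu) G.
have hV := hnorm_ge0 (L2inner mu) (isometry_adjoint G).
have c0 : 0 < c by rewrite /c -addrA ltr_wpDr// addr_ge0.
have zE : `|z| = (complex.Re `|z|)%:C%C.
  by have := normr_ge0 z; case: `|z| => a b; rewrite lecE /= => /andP[/eqP->].
have r0 : 0 < complex.Re `|z| by rewrite -ltcR -zE normr_gt0.
have [N FN] := trunc_approx F (divr_gt0 r0 c0).
set D := F - _ in FN.
have zD : z = L2inner mu G (U D) - L2inner mu (isometry_adjoint G) D.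
  rewrite /D linearB /= !dotBr dot_isometry_trunc dot_truncr.
  rewrite (eq_bigr (fun n : 'I_N => (L2rep F n)^* *
    L2inner mu (isometry_adjoint G) (delta m n))); last first.
    by move=> n _; rewrite dot_delta isometry_adjointE.
  by rewrite opprB addrA addrNK.
have : `|z| <= (hn D * c)%:C%C.
  rewrite zD (le_trans (ler_normB _ _))//.
  apply: le_trans (lerD (cauchy_schwarz _ _ _) (cauchy_schwarz _ _ _)) _.
  rewrite -rmorphD lecR isoU /c.
  by rewrite -mulrDl mulrC ler_wpM2l ?hnorm_ge0// -addrA lerDr ler01.
rewrite zE lecR leNgt => /negP; apply.
by rewrite -ltr_pdivlMr.
Qed.

Lemma isometry_adjoint_exists : exists V : {linear H -> H},
  forall F G, L2inner mu (U F) G = L2inner mu F (V G).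
Proof. by exists isometry_adjoint; exact: isometry_adjointP. Qed.

End AdjointOfIsometry.
End Truncation.

(** * The isometric part of a composition operator *)

Section MeasureNat.
Context (R : realType).

(** Countable additivity reduces a set to its points. *)
Lemma measure_nat_ext (nu1 nu2 : {measure set nat -> \bar R}) :
  (forall n, nu1 [set n] = nu2 [set n]) -> forall M, nu1 M = nu2 M.
Proof.
move=> nu12 M; rewrite -[M](image_id M) -bigcup_imset1.
rewrite !measure_bigcup//; first by apply: eq_eseriesr => n _.
by move=> i j _ _ [n [/= -> ->]].
by move=> i j _ _ [n [/= -> ->]].
Qed.

End MeasureNat.

Section WeightedComposition.
Context (R : realType) (m : nat -> {posnum R}) (k : nat -> R) (phi : nat -> nat).
Local Notation mu := (discrete_measure m).
Local Notation H := (L2 mu).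
Local Notation hn := (hnorm (L2inner mu)).
Hypotheses (k_gt0 : forall n, 0 < k n)
  (fibre : forall n, mu (phi @^-1` [set n]) = (k n ^+ 2 * (m n)%:num)%:E).
Implicit Types (F G : H).

(** Change of variables: the image of mu under phi gives n the mass of its fibre. *)
Lemma pushforward_fibre (a : nat -> R) : (forall n, 0 <= a n) ->
  (\sum_(0 <= x <oo) ((m x)%:num * a (phi x))%:E =
   \sum_(0 <= n <oo) ((m n)%:num * (k n ^+ 2 * a n))%:E)%E.
Proof.
move=> a0.
have w0 n : 0 <= k n ^+ 2 * (m n)%:num by rewrite mulr_ge0// sqr_ge0.
pose nu := atomic (fun n => NngNum (w0 n)) (id : nat -> nat).
have nuE M : pushforward mu phi M = nu M.
  apply: (@measure_nat_ext _ (pushforward mu phi) nu) => [//|? n].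
  rewrite [LHS]fibre /nu atomicE (@nneseries_single _ _ n).
  - by rewrite /= indicE mem_set// mulr1.
  - by rewrite lee_fin mulr_ge0.
  - by move=> i ni; rewrite /= indicE memNset ?mulr0//; exact/eqP.
transitivity (\int[nu]_n (a n)%:E)%E; last first.
  rewrite ge0_integral_atomic//=.
  by apply: eq_eseriesr => n _; rewrite -EFinM; congr _%:E; rewrite mulrCA mulrA.
transitivity (\int[mu]_x (a (phi x))%:E)%E.
  by rewrite ge0_integral_atomic// => x; rewrite lee_fin.
transitivity (\int[pushforward mu phi]_n (a n)%:E)%E.
  by rewrite ge0_integral_pushforward// => ? _; rewrite lee_fin.
by apply: eq_measure_integral => [//|? M _ _]; exact: nuE.
Qed.

(** The factor 1 / k compensates the ratio k^2 between the mass of a fibre and that of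
its base point. *)
Lemma sumsq_comp_isometry F :
  sumsq m (fun x => (k (phi x))^-1%:C%C * L2rep F (phi x)) = sumsq m (L2rep F).
Proof.
rewrite /sumsq (pushforward_fibre (a := fun n => sqmod ((k n)^-1%:C%C * L2rep F n))).
  apply: eq_eseriesr => n _; congr (_ * _)%:E.
  by rewrite sqmodZ mulrA -exprMn mulfV ?gt_eqF// expr1n mul1r.
by move=> n; exact: sqmod_ge0.
Qed.

Fact comp_isometry_subproof F : {G : H |
  forall x, L2rep G x = (k (phi x))^-1%:C%C * L2rep F (phi x)}.
Proof.
exists (ofun m (fun x => (k (phi x))^-1%:C%C * L2rep F (phi x))) => x.
by rewrite ofunE// sumsq_comp_isometry sumsq_L2rep.
Qed.

Definition comp_isometry F : H := sval (comp_isometry_subproof F).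

Lemma comp_isometryE F x :
  L2rep (comp_isometry F) x = (k (phi x))^-1%:C%C * L2rep F (phi x).
Proof. exact: (svalP (comp_isometry_subproof F)). Qed.

Lemma comp_isometry_linear : linear comp_isometry.
Proof.
move=> a F G; apply: L2_ext => x.
rewrite comp_isometryE [RHS]L2repD L2repZ !comp_isometryE L2repD L2repZ.
by rewrite mulrDr mulrCA.
Qed.

HB.instance Definition _ :=
  GRing.isLinear.Build R[i] H H *:%R comp_isometry comp_isometry_linear.

Lemma comp_isometry_exists : exists U : {linear H -> H},
  (forall F x, L2rep (U F) x = (k (phi x))^-1%:C%C * L2rep F (phi x)) /\
  (forall F, hn (U F) = hn F).
Proof.
exists comp_isometry; split=> [F x|F]; first exact: comp_isometryE.
apply/eqP; rewrite -(@eqrXn2 _ 2)// ?hnorm_ge0//; apply/eqP.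
apply: EFin_inj; rewrite !hnorm_sumsq -(sumsq_comp_isometry F); congr sumsq.
by apply/funext => x; exact: comp_isometryE.
Qed.

End WeightedComposition.

(** * Composition operators on a discrete measure space *)

Section CompositionOperator.
Context (R : realType) (m : nat -> {posnum R}) (k : nat -> R) (phi : nat -> nat).
Local Notation mu := (discrete_measure m).
Local Notation H := (L2 mu).
Local Notation hn := (hnorm (L2inner mu)).
Hypotheses (k_gt0 : forall n, 0 < k n)
  (fibre : forall n, mu (phi @^-1` [set n]) = (k n ^+ 2 * (m n)%:num)%:E).
Variables (U V : {linear H -> H}).
Hypotheses (UE : forall F x, L2rep (U F) x = (k (phi x))^-1%:C%C * L2rep F (phi x))
  (isoU : forall F, hn (U F) = hn F)
  (adjUV : forall F G, L2inner mu (U F) G = L2inner mu F (V G)).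
Implicit Types (F G : H).

Let C := composition_operator mu phi.

Lemma le_hnorm F G : (forall n, sqmod (L2rep F n) <= sqmod (L2rep G n)) ->
  hn F <= hn G.
Proof.
move=> FG; rewrite -(@ler_pXn2r _ 2)// ?nnegrE ?hnorm_ge0//.
rewrite -lee_fin !hnorm_sumsq; apply: lee_nneseries => [n _ _|n _].
  by rewrite lee_fin mulr_ge0// sqmod_ge0.
by rewrite lee_fin ler_pM2l.
Qed.

Lemma adjoint_isometryK : cancel U V.
Proof.
move=> F; apply/eqP; rewrite -subr_eq0; apply/eqP.
apply: (@dot_ext _ _ (L2inner mu)) => G.
by rewrite dotBl (adjVU adjUV) isometry_dot// subrr.
Qed.

Lemma dot_isometry_delta G n :
  L2inner mu G (U (delta m n)) = (m n)%:num%:C%C * L2rep (V G) n.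
Proof. by rewrite -(adjVU adjUV) dot_delta. Qed.

(** Multiplying by k and then dividing by k o phi after composing with phi leaves the
composition with phi; that k f is square summable when f o phi is follows from the
change of variables. *)
Lemma composition_operatorE : C = ocomp (graph U) (mulop k).
Proof.
apply/seteqP; split=> -[F G] /=.
  move=> /ae_discreteP /= FG.
  pose kF := ofun m (fun n => (k n)%:C%C * L2rep F n).
  have kFE n : L2rep kF n = (k n)%:C%C * L2rep F n.
    rewrite ofunE//; apply: le_lt_trans (sumsq_L2rep G); rewrite le_eqVlt.
    apply/orP; left; apply/eqP.
    transitivity (\sum_(0 <= n <oo)
        ((m n)%:num * (k n ^+ 2 * sqmod (L2rep F n)))%:E)%E.
      by apply: eq_eseriesr => i _; rewrite sqmodZ.
    rewrite -(pushforward_fibre fibre (a := fun n => sqmod (L2rep F n))).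
      by apply: eq_eseriesr => i _; rewrite FG.
    by move=> i; exact: sqmod_ge0.
  exists kF => //; rewrite /graph /=; apply: L2_ext => x.
  rewrite UE kFE FG mulrA -rmorphM /= mulVf ?gt_eqF//.
  by rewrite rmorph1 mul1r.
case=> kF kFE; rewrite /graph /= => ->; apply/ae_discreteP => x /=.
rewrite UE kFE mulrA -rmorphM /= mulVf ?gt_eqF//.
by rewrite rmorph1 mul1r.
Qed.

Lemma mulop_trunc g N f :
  mulop g (trunc m N f, trunc m N (fun n => (g n)%:C%C * f n)).
Proof. by move=> n /=; rewrite !truncE; case: ifP => // _; rewrite mulr0. Qed.

Lemma adjoint_composition :
  adjoint (L2inner mu) C = ocomp (mulop k) (graph V).
Proof.
rewrite composition_operatorE (adjoint_isometryl adjUV)//.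
exact: adjoint_mulop.
Qed.

(** V g (n) only involves the values of g on the fibre over n, where k o phi is the
constant k n. *)
Lemma mulop_adjoint_comm F G :
  (forall x, L2rep G x = (k (phi x))%:C%C * L2rep F x) ->
  mulop k (V F, V G).
Proof.
move=> FG n /=.
have mn0 : (m n)%:num%:C%C != 0 :> R[i] by rewrite eq_complex /= eqxx andbT.
apply: (mulfI mn0); rewrite -dot_isometry_delta mulrCA -dot_isometry_delta -dotZl.
rewrite !L2innerE.
congr cintegral; apply/funext => x; rewrite UE deltaE FG L2repZ.
by case: eqVneq => [->//|_]; rewrite !mulr0 rmorph0 !mulr0.
Qed.

(** If f is in the domain of A, then (k o phi) f is square summable because
k o phi <= k, and A V f = V ((k o phi) f), so the contraction V gives
|A V f| <= |(k o phi) f| <= |A f| = |U A f|. *)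
Lemma composition_hyponormal : (forall x, k (phi x) <= k x) ->
  hyponormal (L2inner mu) C.
Proof.
move=> kphi.
have key F kF : mulop k (F, kF) -> exists2 G, mulop k (V F, V G) & hn G <= hn kF.
  move=> FkF; pose G := ofun m (fun x => (k (phi x))%:C%C * L2rep F x).
  have le x : sqmod ((k (phi x))%:C%C * L2rep F x) <= sqmod (L2rep kF x).
    rewrite FkF !sqmodZ ler_wpM2r ?sqmod_ge0//.
    by rewrite ler_pXn2r ?nnegrE ?(ltW (k_gt0 _)).
  have GE x : L2rep G x = (k (phi x))%:C%C * L2rep F x.
    rewrite ofunE//; apply: le_lt_trans (sumsq_L2rep kF).
    apply: lee_nneseries => [n _ _|n _].
      by rewrite lee_fin mulr_ge0// sqmod_ge0.
    by rewrite lee_fin ler_pM2l.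
  exists G; first exact: mulop_adjoint_comm.
  by apply: le_hnorm => x; rewrite GE.
rewrite /hyponormal adjoint_composition composition_operatorE; split.
- move=> F e e0; have [N FN] := trunc_approx F e0.
  exists (trunc m N (L2rep F)) => //.
  exists (U (trunc m N (fun n => (k n)%:C%C * L2rep F n))).
  exists (trunc m N (fun n => (k n)%:C%C * L2rep F n)) => //.
  exact: mulop_trunc.
- move=> F [Y [kF FkF _]]; have [G VFG _] := key _ _ FkF.
  by exists (V G); apply/ocomp_graphr.
- move=> F Y K [kF FkF]; rewrite /graph /= => -> /ocomp_graphr VFK.
  have [G VFG GkF] := key _ _ FkF.
  have [_ _ funct] := is_operator_mulop m k.
  rewrite (funct _ _ _ VFK VFG) isoU (le_trans _ GkF)//.
  exact: (hnorm_coisometry adjUV adjoint_isometryK).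
Qed.

Hypothesis growth : forall n (s B : R), 0 < s ->
  exists2 x, phi x = n & B <= (m x)%:num * (k x `^ s) ^+ 2.

(** If F n were nonzero for some F in the domain, the image K of F would satisfy
|K x|^2 = c (k x `^ t)^2 with a constant c > 0 at all points x of the fibre over
n. Already the single terms m x |K x|^2 of |K|^2 are unbounded there. *)
Lemma dom_aluthge_composition t : 0 < t ->
  dom (ocomp (mulop (fun n => k n `^ t))
    (ocomp (graph U) (mulop (fun n => k n `^ (1 - t))))) = [set 0].
Proof.
move=> t0; apply/seteqP; split=> F /=; last first.
  move=> ->; exists 0; exists (U 0); last by move=> n /=; rewrite linear0 !L2rep0 mulr0.
  by exists 0 => // n /=; rewrite !L2rep0 mulr0.
case=> K [G [F' FF']]; rewrite /graph /= => -> GK.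
apply: L2_ext => n; rewrite L2rep0; apply/eqP/negPn/negP => Fn0.
pose c := ((k n)^-1 * k n `^ (1 - t)) ^+ 2 * sqmod (L2rep F n).
have c0 : 0 < c.
  rewrite mulr_gt0//.
    by rewrite exprn_gt0// mulr_gt0 ?invr_gt0// powR_gt0.
  rewrite lt_neqAle sqmod_ge0 andbT eq_sym; move: Fn0; apply: contra_neq.
  case: (L2rep F n) => a b; rewrite /sqmod /= => /eqP.
  by rewrite paddr_eq0 ?sqr_ge0// !sqrf_eq0 => /andP[/eqP-> /eqP->].
have [x xn Bx] := growth n ((hn K ^+ 2 + 1) / c) t0.
have := sqmod_le_hnorm K x.
rewrite GK /= UE xn FF' /= !sqmodZ.
rewrite [leLHS](_ : _ = (m x)%:num * (k x `^ t) ^+ 2 * c); last first.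
  by rewrite /c exprMn; ring.
rewrite leNgt => /negP; apply; move: Bx; rewrite ler_pdivrMr//.
by apply: lt_le_trans; rewrite ltrDl.
Qed.

Lemma V_delta x :
  V (delta m x) = ((m x)%:num / ((m (phi x))%:num * k (phi x)))%:C%C *: delta m (phi x).
Proof.
apply: L2_ext => n.
have mn0 : (m n)%:num%:C%C != 0 :> R[i] by rewrite eq_complex /= eqxx andbT.
apply: (mulfI mn0); rewrite -dot_isometry_delta dot_conj dot_delta UE.
rewrite !deltaE L2repZ deltaE.
rewrite eq_sym; case: eqVneq => [->|_]; last by rewrite !mulr0 rmorph0.
rewrite !mulr1 -!rmorphM /= conj_realC; congr (_%:C%C).
by field; rewrite !gt_eqF.
Qed.

(** As x runs through the fibre over 0, the functions U (c delta_x) below are all sent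
to the same nonzero multiple G of U (delta_0), while their norms come arbitrarily
close to 0. Hence (0, G) belongs to the closure of the graph. *)
Lemma aluthge_adjoint_not_closable t : t < 1 ->
  ~ closable (L2inner mu) (ocomp (graph U) (ocomp (mulop (fun n => k n `^ t))
      (ocomp (graph V) (ocomp (mulop (fun n => k n `^ (1 - t))) (graph V))))).
Proof.
move=> t1; set D := ocomp _ _ => -[_ _ funct].
pose G := (k 0%N `^ t / ((m 0%N)%:num * k 0%N))%:C%C *: U (delta m 0%N).
have G0 : G = 0.
  apply: (funct 0) => e e0; last first.
    exists (0, 0); rewrite subrr hnorm0; split=> //.
    exists 0; last by rewrite /graph /= linear0.
    exists 0; last by move=> n /=; rewrite !L2rep0 mulr0.
    exists 0; last by rewrite /graph /= linear0.
    by apply/ocomp_graphr => n /=; rewrite linear0 !L2rep0 mulr0.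
  have s0 : 0 < 1 - t by rewrite subr_gt0.
  have [x x0 Bx] := growth 0%N (2 / e ^+ 2) s0.
  (* the factor for which V A^(1-t) sends c delta_x to a multiple of delta_0
     that does not depend on x *)
  pose c := (k x `^ (1 - t) * (m x)%:num)^-1.
  have kx0 : 0 < k x `^ (1 - t) by exact: powR_gt0.
  have c0 : 0 < c by rewrite invr_gt0 mulr_gt0.
  exists (U (c%:C%C *: delta m x), G); rewrite subrr hnorm0; split=> //; last first.
    rewrite /= sub0r hnormN isoU hnormZ ?ltW//.
    rewrite -(@ltr_pXn2r _ 2)// ?nnegrE ?mulr_ge0 ?hnorm_ge0 ?ltW//.
    rewrite exprMn hnorm_delta.
    set A := (m x)%:num * _ in Bx.
    have A0 : 0 < A by rewrite mulr_gt0// exprn_gt0.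
    have -> : c ^+ 2 * (m x)%:num = A^-1.
      by rewrite /c /A; field; rewrite !gt_eqF.
    rewrite invf_plt ?posrE ?exprn_gt0// (lt_le_trans _ Bx)//.
    by rewrite -[ltLHS]mul1r ltr_pM2r ?invr_gt0 ?exprn_gt0// ltr1n.
  exists ((k 0%N `^ t / ((m 0%N)%:num * k 0%N))%:C%C *: delta m 0%N); last first.
    by rewrite /graph /= linearZ.
  exists (V ((m x)%:num^-1%:C%C *: delta m x)); last first.
    rewrite linearZ /= V_delta x0 => n /=; rewrite !L2repZ !deltaE.
    case: eqVneq => [->|_]; last by rewrite !mulr0.
    rewrite !mulr1 -!rmorphM /=; congr _%:C%C.
    by field; rewrite !gt_eqF.
  exists ((m x)%:num^-1%:C%C *: delta m x); last by [].
  apply/ocomp_graphr; rewrite adjoint_isometryK => n /=; rewrite !L2repZ !deltaE.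
  case: eqVneq => [->|_]; last by rewrite !mulr0.
  rewrite !mulr1 -!rmorphM /=; congr _%:C%C.
  by rewrite /c; field; rewrite !gt_eqF.
have : hn G = 0 by rewrite G0 hnorm0.
rewrite hnormZ ?divr_ge0 ?powR_ge0 ?mulr_ge0 ?ltW// isoU => /eqP.
rewrite mulf_eq0 gt_eqF ?divr_gt0 ?powR_gt0 ?mulr_gt0//= => /eqP d0.
by have := hnorm_delta m 0%N; rewrite d0 expr2 mul0r => /eqP; rewrite lt_eqF//.
Qed.

End CompositionOperator.

(** * The weighted tree *)

Lemma eseries_half (R : realType) (r : R) : 0 <= r ->
  (\sum_(0 <= i <oo) (r / (2 ^ i.+1)%:R)%:E = r%:E)%E.
Proof.
move=> r0; apply/cvg_lim => //.
rewrite (_ : (fun n => _) = EFin \o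
    (fun n => \sum_(0 <= i < n) (r / (2 ^ (i + 1))%:R))%R); last first.
  by apply/funext => n /=; rewrite sumEFin; under [in RHS]eq_bigr do rewrite addn1.
apply: cvg_comp; last by apply cvg_refl.
by have := cvg_geometric_series_half r 0; rewrite expr0 divr1; apply: cvg_trans.
Qed.

Section Tree.
Context (R : realType).
Implicit Types (s : seq nat) (i n x : nat).

(** The function k on the tree. At the root its square is 2, because the fibre of the
root consists of the root itself, of mass 1, and of children of total mass 1. *)
Fixpoint tree_slope s : R :=
  if s is i :: s' then 2 ^+ (i * i) * tree_slope s' else Num.sqrt 2.

(** The total mass of the children of s when s has mass w: the whole fibre, of mass
k^2 w, except at the root, which belongs to its own fibre. *)
Definition offspring s (w : R) : R :=
  if s is [::] then 1 else tree_slope s ^+ 2 * w.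

(** The mass of the children is distributed geometrically, which keeps it finite. *)
Fixpoint tree_weight s : R :=
  if s is i :: s' then offspring s' (tree_weight s') / (2 ^ i.+1)%:R else 1.

Lemma tree_slope_gt0 s : 0 < tree_slope s.
Proof. by elim: s => [|i s IH] /=; rewrite ?sqrtr_gt0// mulr_gt0// exprn_gt0. Qed.

Lemma offspring_gt0 s w : 0 < w -> 0 < offspring s w.
Proof.
by case: s => [//|i s] w0; rewrite /offspring mulr_gt0// exprn_gt0// tree_slope_gt0.
Qed.

Lemma tree_weight_gt0 s : 0 < tree_weight s.
Proof.
by elim: s => [//|i s IH] /=; rewrite divr_gt0// ?offspring_gt0// ltr0n expn_gt0.
Qed.

Definition weight n : {posnum R} := PosNum (tree_weight_gt0 (CodeSeq.decode n)).
Definition slope n : R := tree_slope (CodeSeq.decode n).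
Definition parent n : nat := CodeSeq.code (behead (CodeSeq.decode n)).
Definition child i n : nat := CodeSeq.code (i :: CodeSeq.decode n).

Lemma parent_child i n : parent (child i n) = n.
Proof. by rewrite /parent /child CodeSeq.codeK CodeSeq.decodeK. Qed.

Lemma slope_child i n : slope (child i n) = 2 ^+ (i * i) * slope n.
Proof. by rewrite /slope /child CodeSeq.codeK. Qed.

Lemma weight_child i n : (weight (child i n))%:num =
  offspring (CodeSeq.decode n) (weight n)%:num / (2 ^ i.+1)%:R.
Proof. by rewrite /= /child CodeSeq.codeK. Qed.

Lemma slope_parent n : slope (parent n) <= slope n.
Proof.
rewrite /slope /parent CodeSeq.codeK; case: (CodeSeq.decode n) => //= i s.
by rewrite ler_peMl ?(ltW (tree_slope_gt0 _))// exprn_ege1// ler1n.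
Qed.

Lemma child_inj n : injective (child^~ n).
Proof.
by move=> i j /(can_inj CodeSeq.codeK) [].
Qed.

Lemma measure_children n :
  discrete_measure weight (range (child^~ n)) =
  (offspring (CodeSeq.decode n) (weight n)%:num)%:E.
Proof.
rewrite -bigcup_imset1 measure_bigcup//; last first.
  by move=> i j _ _ [x [/= -> /child_inj]].
rewrite -[RHS]eseries_half; last exact/ltW/offspring_gt0.
rewrite eseries_mkcond; apply: eq_eseriesr => i _; rewrite ifT ?in_setT//.
by rewrite [LHS]discrete_measure1 weight_child.
Qed.

(** The fibre over n consists of the children of n, together with n itself if n is the
root. *)
Lemma measure_fibre n :
  discrete_measure weight (parent @^-1` [set n]) =
  (slope n ^+ 2 * (weight n)%:num)%:E.
Proof.
have mem x : parent x = n -> CodeSeq.decode x != [::] -> range (child^~ n) x.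
  move=> <-; case xs : (CodeSeq.decode x) => [//|i s] _; exists i => //.
  by rewrite /parent /child xs CodeSeq.codeK -xs CodeSeq.decodeK.
have [n0|n0] := eqVneq (CodeSeq.decode n) [::]; last first.
  rewrite (_ : _ @^-1` _ = range (child^~ n)); last first.
    apply/seteqP; split=> x /=; last by case=> i _ <-; rewrite parent_child.
    move=> xn; apply: mem => //; apply: contra_neq n0 => x0.
    by rewrite -xn /parent x0 CodeSeq.codeK.
  rewrite [LHS]measure_children /offspring /slope.
  by case: (CodeSeq.decode n) n0.
rewrite (_ : _ @^-1` _ = range (child^~ n) `|` [set n]); last first.
  apply/seteqP; split=> x /=; last first.
    by move=> [[i _ <-]|->]; rewrite ?parent_child// /parent n0 -[RHS]CodeSeq.decodeK n0.
  move=> xn; have [x0|/(mem _ xn)] := eqVneq (CodeSeq.decode x) [::]; last by left.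
  by right; apply: (can_inj CodeSeq.decodeK); rewrite x0 n0.
rewrite measureU//; last first.
  apply/seteqP; split=> // x [/= [i _ <-] /(congr1 CodeSeq.decode)].
  by rewrite n0 /child CodeSeq.codeK.
rewrite [X in (X + _)%E]measure_children [X in (_ + X)%E]discrete_measure1.
by rewrite /slope /= n0 /= sqr_sqrtr// mulr1 -EFinD.
Qed.

(** The mass of the i-th child decays like 2^-i only, whereas (k^s)^2 is multiplied by
(2^(i^2))^(2s), which is at least 4^i as soon as i s >= 1. *)
Lemma slope_growth n (s B : R) : 0 < s ->
  exists2 x, parent x = n & B <= (weight x)%:num * (slope x `^ s) ^+ 2.
Proof.
move=> s0; set w := offspring (CodeSeq.decode n) (weight n)%:num.
have w0 : 0 < w by exact: offspring_gt0.
have kn0 : 0 < slope n by exact: tree_slope_gt0.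
pose c := w * (slope n `^ s) ^+ 2.
have c0 : 0 < c by rewrite mulr_gt0// exprn_gt0// powR_gt0.
(* the first summand makes i s >= 1; the second makes the remaining gain
   c 2^i / 2 >= c i / 2 reach B *)
pose i := (Num.bound s^-1 + Num.bound (2 * `|B| / c))%N.
exists (child i n); first exact: parent_child.
have is1 : 1 <= i%:R * s.
  rewrite -ler_pdivrMr// div1r (le_trans (ltW (archi_boundP _)))//.
    by rewrite invr_ge0 ltW.
  by rewrite ler_nat leq_addr.
have iB : 2 * `|B| / c <= i%:R.
  rewrite (le_trans (ltW (archi_boundP _)))//.
    by rewrite divr_ge0 ?(ltW c0)// mulr_ge0.
  by rewrite ler_nat leq_addl.
have pow : 2 ^+ i <= (2 ^+ (i * i)) `^ s :> R.
  rewrite exprM -[in leRHS]powR_mulrn ?exprn_ge0// -powRrM.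
  rewrite -[leLHS]powRr1 ?exprn_ge0// ler_powR// exprn_ege1// ler1n.
  by [].
rewrite weight_child slope_child powRM ?exprn_ge0 ?(ltW kn0)//.
apply: le_trans (_ : c * 2 ^+ i / 2 <= _).
  rewrite ler_pdivlMr//; apply: (@le_trans _ _ (2 * `|B|)).
    by rewrite mulrC ler_pM2l// ler_norm.
  move: iB; rewrite ler_pdivrMr// => /le_trans; apply.
  by rewrite mulrC ler_pM2l// -natrX ler_nat ltnW// ltn_expl.
rewrite -/w exprMn natrX exprS.
have e0 : 0 < 2 ^+ i :> R by exact: exprn_gt0.
have E (e a v : R) : 0 < e ->
    v * a ^+ 2 * e / 2 = v / (2 * e) * (e ^+ 2 * a ^+ 2).
  by move=> e1; field; rewrite gt_eqF.
rewrite /c (E _ _ _ e0) ler_pM2l ?divr_gt0 ?mulr_gt0//.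
rewrite ler_pM2r ?exprn_gt0 ?powR_gt0//.
by rewrite ler_pXn2r ?nnegrE ?powR_ge0 ?exprn_ge0.
Qed.

End Tree.

(** * The counterexample *)

Lemma discrete_sigma_finite (R : realType) (m : nat -> {posnum R}) :
  sigma_finite setT (discrete_measure m).
Proof.
exists (fun n => [set n]); first by rewrite bigcup_imset1 image_id.
by move=> n; split=> //; rewrite [ltLHS]discrete_measure1 ltry.
Qed.

(** A set of measure 0 is empty. *)
Lemma discrete_nonsingular (R : realType) (m : nat -> {posnum R}) phi :
  nonsingular (discrete_measure m) phi.
Proof.
move=> M _ M0; rewrite (_ : M = set0) ?preimage_set0 ?measure0//.
apply/seteqP; split=> // n Mn.
have : (discrete_measure m [set n] <= discrete_measure m M)%E.
  by apply: le_measure; rewrite ?inE// => _ ->.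
by rewrite M0 discrete_measure1 lee_fin leNgt gt0.
Qed.

Theorem theorem6p6 (R : realType) :
  exists (d : measure_display) (X : measurableType d)
         (mu : {measure set X -> \bar R}) (phi : X -> X),
    [/\ sigma_finite setT mu, measurable_fun setT phi & nonsingular mu phi] /\
    let C := composition_operator mu phi in
    [/\ hyponormal (L2inner mu) C,
        forall t : R, 0 < t <= 1 ->
          exists D, is_aluthge (L2inner mu) t C D /\ dom D = [set 0] &
        forall t : R, 0 < t < 1 ->
          exists D, is_aluthge (L2inner mu) t (adjoint (L2inner mu) C) D /\
                    ~ closable (L2inner mu) D].
Proof.
exists _, nat, (discrete_measure (weight R)), parent; split.
  split=> //; first exact: discrete_sigma_finite.
  exact: discrete_nonsingular.
have k_gt0 n : 0 < slope R n by exact: tree_slope_gt0.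
have fibre := @measure_fibre R.
have [U [UE isoU]] := comp_isometry_exists k_gt0 fibre.
have [V adjUV] := isometry_adjoint_exists isoU.
have UK := adjoint_isometryK isoU adjUV.
pose A := mulop (m := weight R) (slope R).
have opA : is_operator A by exact: is_operator_mulop.
have selfadjA : adjoint (L2inner _) A = A by exact: adjoint_mulop.
have powA t : is_power (L2inner _) A t (mulop (m := weight R) (fun n => slope R n `^ t)).
  by apply: mulop_power => n; exact: ltW.
(* the root of A A is taken with respect to the spectral measure of k^2 *)
have powAA : is_power (L2inner _) (ocomp A A) 2^-1 A.
  rewrite ocomp_mulop.
  rewrite (_ : A = mulop (m := weight R) (fun n => (slope R n * slope R n) `^ 2^-1)).
    by apply: mulop_power => n; rewrite mulr_ge0// ltW.
  congr mulop; apply/funext => n.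
  by rewrite powR12_sqrt ?mulr_ge0 ?ltW// -expr2 sqrtr_sqr gtr0_norm.
have kerA : oker A = [set 0].
  apply/seteqP; split=> F /=; last by move=> -> n /=; rewrite !L2rep0 mulr0.
  move=> F0; apply: L2_ext => n; apply/eqP.
  have /eqP := F0 n; rewrite /= !L2rep0 eq_sym mulf_eq0 => /orP[|//].
  by move=> /eqP/(congr1 (@complex.Re R)) /= s0; have := k_gt0 n; rewrite s0 ltxx.
rewrite /= (adjoint_composition k_gt0 fibre UE adjUV).
rewrite (composition_operatorE k_gt0 fibre UE); split.
- rewrite -(composition_operatorE k_gt0 fibre UE).
  exact: (composition_hyponormal k_gt0 fibre UE isoU adjUV (@slope_parent R)).
- move=> t /andP[t0 t1]; eexists; split.
    exact: (aluthge_isometry adjUV UK).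
  exact: (dom_aluthge_composition k_gt0 UE (@slope_growth R)).
- move=> t /[dup] t01 /andP[t0 t1]; eexists; split.
    exact: (aluthge_coisometry adjUV UK).
  exact: (aluthge_adjoint_not_closable k_gt0 UE isoU adjUV (@slope_growth R)).
Qed.
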